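(* Let $\rho>0$ and let $\delta>0$ be a fixed, sufficiently small constant. Consider the planar system $x'=|x|-|y|+\lambda\varepsilon,\ y'=\varepsilon$. For each fixed $\lambda>0$ there exists $\varepsilon_0>0$ such that the following statements hold for $\varepsilon\in(0,\varepsilon_0]$ (orders are understood as $\varepsilon\searrow 0$ with $\lambda,\rho,\delta$ fixed). (a) If $\lambda>1$, then the orbit $\gamma_{\mathbf{p}_a^-}$ through the point $\mathbf{p}_a^-=(0,\varepsilon(1-\lambda))$ passes through the section $\Delta^{\text{out}}_e$ at a point $(\rho,h(\varepsilon))$, where $h(\varepsilon)=O(\varepsilon\ln(\varepsilon))$. The section $\Delta^{\text{in}}$ is mapped by the transition map $\Pi_e:\Delta^{\text{in}}\to\Delta^{\text{out}}_e$ to an interval containing $\gamma_{\mathbf{p}_a^-}\cap\Delta^{\text{out}}_e$ of size $O(e^{-c/\varepsilon})$, where $c$ is a positive constant. (b) If $\lambda<1$, then $\Delta^{\text{in}}$ is mapped by the transition map $\Pi_a:\Delta^{\text{in}}\to\Delta^{\text{out}}_a$ to an interval containing $\mathcal{S}_{a,\varepsilon}^{+}\cap\Delta^{\text{out}}_a$ of size $O(e^{-c/\varepsilon})$, where $c$ is a positive constant.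
   Context: The system is $x'=|x|-|y|+\lambda\varepsilon,\ y'=\varepsilon$ with $0<\varepsilon\ll1$ and $\lambda>0$; its vector field is globally Lipschitz, so solutions are unique. Canonical attracting slow manifolds (half-lines): $$\mathcal{S}_{a,\varepsilon}^-=\{(x,y): y=x+\varepsilon(1-\lambda),\ x<\min\{0,\varepsilon(\lambda-1)\}\},\qquad \mathcal{S}_{a,\varepsilon}^+=\{(x,y): y=-x+\varepsilon(1+\lambda),\ x<0\}.$$ The point $\mathbf{p}_a^-=(x,\,x+\varepsilon(1-\lambda))$ with $x=\min\{0,\varepsilon(\lambda-1)\}$ is the boundary point of $\mathcal{S}_{a,\varepsilon}^-$, and $\gamma_{\mathbf{p}_a^-}$ is the orbit through it. The crossing sections are $$\Delta^{\text{in}}=\{(-\rho,-\rho+\varepsilon(1-\lambda)+r):|r|<\delta\},$$ $$\Delta^{\text{out}}_a=\{(-\rho,\rho+\varepsilon(1+\lambda)+r):|r|<\delta\},\qquad \Delta^{\text{out}}_e=\{(\rho,r):|r|<\delta\}.$$ The transition maps $\Pi_e:\Delta^{\text{in}}\to\Delta^{\text{out}}_e$ and $\Pi_a:\Delta^{\text{in}}\to\Delta^{\text{out}}_a$ send a point of $\Delta^{\text{in}}$ to the intersection of its forward orbit with $\Delta^{\text{out}}_e$, respectively $\Delta^{\text{out}}_a$.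
   Formalization: In (b), ''mapped to an interval containing S_a^+ ∩ Δ_a^out'' is read as ''mapped into'' such an interval (the image itself is also shown to be an interval), because the image need not contain that point: for λ < ln 2 all orbits from Δ^in hit Δ_a^out strictly below S_a^+. *)

(* Defs.v *)
From Stdlib Require Import Reals.
From Coquelicot Require Import Coquelicot.
Open Scope R_scope.

Definition is_solution (lam eps : R) (x y : R -> R) : Prop :=
  forall t : R,
    is_derive x t (Rabs (x t) - Rabs (y t) + lam * eps) /\
    is_derive y t eps.

(* The vector field is globally Lipschitz, so through every point there is
   exactly one solution, and it is defined for all times. *)
Definition orbit (lam eps : R) (p q : R * R) : Prop :=
  exists x y : R -> R,
    is_solution lam eps x y /\ (x 0, y 0) = p /\
    exists t : R, (x t, y t) = q.

Definition forward_orbit (lam eps : R) (p q : R * R) : Prop :=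
  exists x y : R -> R,
    is_solution lam eps x y /\ (x 0, y 0) = p /\
    exists t : R, 0 <= t /\ (x t, y t) = q.

Definition slow_manifold_a_minus (lam eps : R) (q : R * R) : Prop :=
  snd q = fst q + eps * (1 - lam) /\ fst q < Rmin 0 (eps * (lam - 1)).

Definition slow_manifold_a_plus (lam eps : R) (q : R * R) : Prop :=
  snd q = - fst q + eps * (1 + lam) /\ fst q < 0.

(* The endpoint of the half-line [slow_manifold_a_minus]. *)
Definition p_a_minus (lam eps : R) : R * R :=
  let x := Rmin 0 (eps * (lam - 1)) in (x, x + eps * (1 - lam)).

Definition Delta_in (rho delta lam eps : R) (q : R * R) : Prop :=
  exists r : R, Rabs r < delta /\ q = (- rho, - rho + eps * (1 - lam) + r).

Definition Delta_out_a (rho delta lam eps : R) (q : R * R) : Prop :=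
  exists r : R, Rabs r < delta /\ q = (- rho, rho + eps * (1 + lam) + r).

Definition Delta_out_e (rho delta : R) (q : R * R) : Prop :=
  exists r : R, Rabs r < delta /\ q = (rho, r).

(* On the section [Din], [Pi] is well defined by the flow: the forward orbit of
   each p in [Din] meets [Dout] in the point [Pi p] and nowhere else.  The values
   of [Pi] outside [Din] are irrelevant. *)
Definition is_transition_map (lam eps : R) (Din Dout : R * R -> Prop)
    (Pi : R * R -> R * R) : Prop :=
  forall p : R * R, Din p ->
  forall q : R * R, (forward_orbit lam eps p q /\ Dout q) <-> q = Pi p.

Definition image (f : R * R -> R * R) (A : R * R -> Prop) (q : R * R) : Prop :=
  exists p : R * R, A p /\ f p = q.

Definition vertical (a : R) (J : R -> Prop) (q : R * R) : Prop :=
  fst q = a /\ J (snd q).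

Definition is_interval (J : R -> Prop) : Prop :=
  (exists a : R, J a) /\
  forall a b c : R, J a -> J b -> a <= c <= b -> J c.

(* Rbar-valued so that an unbounded interval has size [p_infty]. *)
Definition size (J : R -> Prop) : Rbar :=
  Rbar_minus (Lub_Rbar J) (Glb_Rbar J).

(* f(eps) = O(g(eps)) as eps decreases to 0. *)
Definition is_bigO_0 (f : R -> Rbar) (g : R -> R) : Prop :=
  exists C : R,
    at_right 0 (fun eps => Rbar_le (Rbar_abs (f eps)) (Finite (C * Rabs (g eps)))).

(* Main.v *)
Require Import Defs.
From Stdlib Require Import Reals Lra Lia ClassicalEpsilon.
From Coquelicot Require Import Coquelicot.
Open Scope R_scope.

(* With [x = eps * eta] and [y = eps * s] every orbit becomes a graph over [s] of a
   solution of [eta' = |eta| - |s| + lam], in which [eps] no longer occurs: the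
   sections now lie at [eta = - N] and [eta = + N] with [N = rho / eps], so the
   theorem is an asymptotic statement about one scalar equation as [N] grows.

   Between the entry section and [s = - lam] the solutions are negative and contract
   exponentially towards the slow manifold, and they reach [s = - lam] within
   [6 exp (- N / 4)] of [eta = - 1].  After that only a bounded time, independent of
   [eps], separates them from the quadrant in which they leave, so Gronwall's
   inequality keeps them exponentially close to the orbit of the slow manifold.  The
   line [s - 1 + lam] is a subsolution for [lam > 1] and a supersolution for
   [lam < 1], which decides the exit: for [lam > 1] one has
   [eta = s + 1 - lam + w exp s] with [w >= lam - 1 > 0] for [s >= 0], and [eta = N]
   at a time [s = O(ln N)]; for [lam < 1] one has [eta = 1 + lam - s + z exp (- s)]
   for large [s], and the crossing with [eta = - N] is exponentially close to the
   slow manifold.  The images of the entry section are intervals by the intermediate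
   value theorem applied in the entry coordinate. *)

(** * Comparison and Gronwall estimates *)

(* [ring] does not see through the canonical structures of Coquelicot. *)
Ltac Rring := match goal with |- ?a = ?b => change (@eq R a b); ring end.

Ltac derive_value H := match type of H with is_derive _ _ ?l =>
  match goal with |- context [Derive ?f ?x] =>
    replace (Derive f x) with l by (symmetry; exact (is_derive_unique _ _ _ H)) end end.

(** Away from 0 the function is locally [z * z] or its negative; at 0 the difference quotient is
    [Rabs h]. *)
Lemma is_derive_mult_abs (x : R) : is_derive (fun z => z * Rabs z) x (2 * Rabs x).
Proof.
destruct (Rtotal_order x 0) as [Hx|[->|Hx]].
- apply is_derive_ext_loc with (fun z => - (z * z)).
    exists (mkposreal (- x) ltac:(lra)); intros z Hz.
    unfold ball in Hz; simpl in Hz; unfold AbsRing_ball, abs, minus, plus, opp in Hz; simpl in Hz.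
    apply Rabs_lt_between in Hz; rewrite Rabs_left by lra; Rring.
  auto_derive; trivial; rewrite Rabs_left by lra; Rring.
- apply is_derive_Reals; intros e He; exists (mkposreal e He); intros h Hh Hhe; simpl in Hhe.
  rewrite Rplus_0_l, Rabs_R0.
  replace ((h * Rabs h - 0 * 0) / h - 2 * 0) with (Rabs h) by (field; assumption).
  now rewrite Rabs_Rabsolu.
- apply is_derive_ext_loc with (fun z => z * z).
    exists (mkposreal x Hx); intros z Hz.
    unfold ball in Hz; simpl in Hz; unfold AbsRing_ball, abs, minus, plus, opp in Hz; simpl in Hz.
    apply Rabs_lt_between in Hz; rewrite Rabs_right by lra; Rring.
  auto_derive; trivial; rewrite Rabs_right by lra; Rring.
Qed.

Lemma derive_nonpos_decreasing (f df : R -> R) (a b : R) : a <= b ->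
  (forall s, a <= s <= b -> is_derive f s (df s)) ->
  (forall s, a <= s <= b -> df s <= 0) -> f b <= f a.
Proof.
intros Hab Hf Hdf.
destruct (MVT_gen f a b df) as [c [Hc Heq]].
- intros s Hs; rewrite Rmin_left, Rmax_right in Hs by lra; apply Hf; lra.
- intros s Hs; rewrite Rmin_left, Rmax_right in Hs by lra.
  apply continuity_pt_filterlim, (ex_derive_continuous f s); exists (df s); apply Hf; lra.
- rewrite Rmin_left, Rmax_right in Hc by lra; specialize (Hdf c Hc); nra.
Qed.

(* [d^2 - d |d|] is twice the square of the negative part of [d], but is
   differentiable; multiplied by [exp (-2 s)] it is nonincreasing. *)
Lemma nonneg_of_derive_ge (d dd : R -> R) (a b : R) : a <= b ->
  (forall s, a <= s <= b -> is_derive d s (dd s)) ->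
  (forall s, a <= s <= b -> - Rabs (d s) <= dd s) ->
  0 <= d a -> 0 <= d b.
Proof.
intros Hab Hd Hdd Ha.
pose (F := fun s => (d s * d s - d s * Rabs (d s)) * exp (- 2 * s)).
assert (HF : F b <= F a).
{ apply derive_nonpos_decreasing with
    (df := fun s => (2 * dd s * (d s - Rabs (d s)) - 2 * (d s * d s - d s * Rabs (d s)))
                    * exp (- 2 * s)); trivial.
  - intros s Hs; unfold F.
    assert (H1 : is_derive (fun s => d s * Rabs (d s)) s (dd s * (2 * Rabs (d s)))).
    { apply (is_derive_comp (fun z => z * Rabs z) d).
      apply is_derive_mult_abs. now apply Hd. }
    assert (H2 := Hd s Hs).
    assert (H3 : is_derive (fun s => exp (- 2 * s)) s (- 2 * exp (- 2 * s))).
    { auto_derive; trivial; ring. }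
    assert (H4 := is_derive_mult _ _ _ _ _ H2 H2 Rmult_comm).
    assert (H5 := is_derive_minus _ _ _ _ _ H4 H1).
    assert (H6 := is_derive_mult _ _ _ _ _ H5 H3 Rmult_comm).
    eapply is_derive_ext; [|eapply eq_ind; [exact H6|]].
    + intros t; reflexivity.
    + unfold plus, mult, minus, opp; simpl; unfold plus, mult, minus, opp; simpl; ring.
  - intros s Hs; specialize (Hdd s Hs).
    assert (He := exp_pos (- 2 * s)).
    assert (Hq : Rabs (d s) * Rabs (d s) = d s * d s)
      by (rewrite <- Rabs_mult; apply Rabs_right; nra).
    assert (Hn := Rle_abs (d s)).
    (* As [d - |d| <= 0], the lower bound on [dd] reverses; the resulting [d^2 - d |d|] is what the
       factor [exp (-2 s)] compensates. *)
    assert (dd s * (d s - Rabs (d s)) <= - Rabs (d s) * (d s - Rabs (d s))) by nra.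
    nra. }
unfold F in HF; rewrite (Rabs_right (d a)) in HF by lra.
destruct (Rle_lt_dec 0 (d b)) as [|Hb]; trivial; exfalso.
rewrite Rabs_left in HF by trivial.
assert (He := exp_pos (- 2 * b)).
assert (0 < (d b * d b - d b * - d b) * exp (- 2 * b)) by (apply Rmult_lt_0_compat; nra).
nra.
Qed.

(** With [E = |d a| exp (s - a)], each of [E - d] and [E + d] has derivative at least [E - |d|],
    hence at least minus its own modulus, and so stays nonnegative. *)
Lemma gronwall_forward (d dd : R -> R) (a b : R) : a <= b ->
  (forall s, a <= s <= b -> is_derive d s (dd s)) ->
  (forall s, a <= s <= b -> Rabs (dd s) <= Rabs (d s)) ->
  Rabs (d b) <= Rabs (d a) * exp (b - a).
Proof.
intros Hab Hd Hdd.
assert (Hsgn : forall sg, sg = 1 \/ sg = - 1 -> 0 <= Rabs (d a) * exp (b - a) - sg * d b).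
{ intros sg Hsg.
  apply nonneg_of_derive_ge with (d := fun s => Rabs (d a) * exp (s - a) - sg * d s)
    (dd := fun s => Rabs (d a) * exp (s - a) - sg * dd s) (a := a); trivial.
  - intros s Hs; assert (H := Hd s Hs).
    auto_derive; [now exists (dd s)|]; derive_value H; unfold Rminus; ring.
  - intros s Hs; specialize (Hdd s Hs).
    assert (He := exp_pos (s - a)).
    assert (0 <= Rabs (d a) * exp (s - a)) by (assert (Ha := Rabs_pos (d a)); nra).
    cbv beta; generalize dependent (Rabs (d a) * exp (s - a)); intros E HE.
    destruct Hsg as [-> | ->]; clear -Hdd HE; revert Hdd; unfold Rabs;
      repeat destruct Rcase_abs; intros; lra.
  - rewrite Rminus_diag, exp_0; destruct Hsg as [-> | ->]; unfold Rabs;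
      destruct Rcase_abs; lra. }
assert (H1 := Hsgn 1 (or_introl eq_refl)); assert (H2 := Hsgn (- 1) (or_intror eq_refl)).
apply Rabs_le; lra.
Qed.

Lemma gronwall (d dd : R -> R) (s t : R) :
  (forall u, Rmin s t <= u <= Rmax s t -> is_derive d u (dd u)) ->
  (forall u, Rmin s t <= u <= Rmax s t -> Rabs (dd u) <= Rabs (d u)) ->
  Rabs (d s) <= Rabs (d t) * exp (Rabs (s - t)).
Proof.
intros Hd Hdd; destruct (Rle_lt_dec t s) as [Hts|Hst].
- rewrite Rmin_right, Rmax_left in * by lra; rewrite (Rabs_right (s - t)) by lra.
  now apply gronwall_forward with dd.
- rewrite Rmin_left, Rmax_right in * by lra; rewrite (Rabs_left (s - t)) by lra.
  assert (H := gronwall_forward (fun u => d (s + t - u)) (fun u => - dd (s + t - u)) s t).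
  simpl in H; replace (s + t - t) with s in H by ring; replace (s + t - s) with t in H by ring.
  replace (- (s - t)) with (t - s) by ring; apply H; [lra| |].
  + intros u Hu; assert (H1 := Hd (s + t - u) ltac:(lra)).
    auto_derive; [now exists (dd (s + t - u))|]. derive_value H1; unfold Rminus; ring.
  + intros u Hu; rewrite Rabs_Ropp; apply Hdd; lra.
Qed.

(** * Uniqueness and comparison for the scaled equation *)

Definition scaled_solution (lam : R) (eta : R -> R) : Prop :=
  forall s : R, is_derive eta s (Rabs (eta s) - Rabs s + lam).

(** Pointwise, because the closed formulas used below solve the equation only while the signs under
    the moduli do not change. *)
Definition solves_at (lam : R) (phi : R -> R) (s : R) : Prop :=
  is_derive phi s (Rabs (phi s) - Rabs s + lam).

(** The modulus is 1-Lipschitz, so Gronwall applies to the difference, which vanishes at [t]. This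
    identifies solutions with closed formulas in both time directions. *)
Lemma solves_unique (lam : R) (eta phi : R -> R) (s t : R) :
  scaled_solution lam eta ->
  (forall u, Rmin s t <= u <= Rmax s t -> solves_at lam phi u) ->
  eta t = phi t -> eta s = phi s.
Proof.
intros He Hp Ht.
assert (H := gronwall (fun u => eta u - phi u)
  (fun u => Rabs (eta u) - Rabs (phi u)) s t).
simpl in H; rewrite Ht, (Rminus_diag (phi t)), Rabs_R0, Rmult_0_l in H.
assert (H0 : Rabs (eta s - phi s) <= 0).
{ apply H.
  - intros u Hu.
    replace (Rabs (eta u) - Rabs (phi u)) with
      (minus (Rabs (eta u) - Rabs u + lam) (Rabs (phi u) - Rabs u + lam))
      by (unfold minus, plus, opp; simpl; ring).
    apply (is_derive_minus eta phi). apply He. now apply Hp.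
  - intros u Hu; apply Rabs_triang_inv2. }
assert (H1 := Rabs_pos (eta s - phi s)).
destruct (Req_dec (eta s - phi s) 0) as [E|E]; [lra|].
apply Rabs_pos_lt in E; lra.
Qed.

Lemma scaled_solution_dependence (lam : R) (eta zeta : R -> R) (s t : R) :
  scaled_solution lam eta -> scaled_solution lam zeta ->
  Rabs (eta s - zeta s) <= Rabs (eta t - zeta t) * exp (Rabs (s - t)).
Proof.
intros He Hz.
apply (gronwall (fun u => eta u - zeta u) (fun u => Rabs (eta u) - Rabs (zeta u))).
- intros u _.
  replace (Rabs (eta u) - Rabs (zeta u)) with
    (minus (Rabs (eta u) - Rabs u + lam) (Rabs (zeta u) - Rabs u + lam))
    by (unfold minus, plus, opp; simpl; ring).
  apply (is_derive_minus eta zeta); trivial.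
- intros u _; apply Rabs_triang_inv2.
Qed.

(** By the reverse triangle inequality [beta - eta] has derivative at least [- |beta - eta|]. *)
Lemma supersolution_le (lam : R) (eta beta dbeta : R -> R) (a b : R) : a <= b ->
  scaled_solution lam eta ->
  (forall s, a <= s <= b -> is_derive beta s (dbeta s)) ->
  (forall s, a <= s <= b -> Rabs (beta s) - Rabs s + lam <= dbeta s) ->
  eta a <= beta a -> eta b <= beta b.
Proof.
intros Hab He Hb Hdb Ha.
assert (H : 0 <= beta b - eta b); [|lra].
apply nonneg_of_derive_ge with (d := fun s => beta s - eta s)
  (dd := fun s => dbeta s - (Rabs (eta s) - Rabs s + lam)) (a := a); trivial; [| |lra].
- intros s Hs; apply (is_derive_minus beta eta); auto.
- intros s Hs; specialize (Hdb s Hs).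
  assert (H := Rabs_triang_inv2 (beta s) (eta s)).
  apply Rabs_le_between in H; lra.
Qed.

Lemma subsolution_ge (lam : R) (eta beta dbeta : R -> R) (a b : R) : a <= b ->
  scaled_solution lam eta ->
  (forall s, a <= s <= b -> is_derive beta s (dbeta s)) ->
  (forall s, a <= s <= b -> dbeta s <= Rabs (beta s) - Rabs s + lam) ->
  beta a <= eta a -> beta b <= eta b.
Proof.
intros Hab He Hb Hdb Ha.
assert (H : 0 <= eta b - beta b); [|lra].
apply nonneg_of_derive_ge with (d := fun s => eta s - beta s)
  (dd := fun s => (Rabs (eta s) - Rabs s + lam) - dbeta s) (a := a); trivial; [| |lra].
- intros s Hs; apply (is_derive_minus eta beta); auto.
- intros s Hs; specialize (Hdb s Hs).
  assert (H := Rabs_triang_inv2 (eta s) (beta s)).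
  apply Rabs_le_between in H; lra.
Qed.

(** * Existence of solutions *)

(** This is [2 cosh (2 s)]. Its integral from 0 is [sinh (2 s)], in modulus at most half the weight,
    so the Picard map contracts by [1 / 2] in the sup norm weighted with it on the whole line. *)
Definition weight (s : R) : R := exp (2 * s) + exp (- (2 * s)).

Lemma weight_ge (s : R) : 1 <= weight s /\ Rabs s <= weight s.
Proof.
unfold weight.
assert (H1 := exp_ineq1_le (2 * s)); assert (H2 := exp_ineq1_le (- (2 * s))).
assert (H3 := exp_pos (2 * s)); assert (H4 := exp_pos (- (2 * s))).
split; [|apply Rabs_le]; lra.
Qed.

Lemma weight_mono (s t : R) : Rabs s <= t -> weight s <= weight t.
Proof.
intros H; apply Rabs_le_between in H.
unfold weight.
assert (Hm : forall a b, 0 <= a <= b -> exp a + exp (- a) <= exp b + exp (- b)).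
{ intros a b [Ha Hab]; rewrite !exp_Ropp.
  assert (H1 : 1 <= exp a) by (rewrite <- exp_0; destruct Ha as [Ha| <-]; [left; now apply exp_increasing|lra]).
  assert (H2 : exp a <= exp b) by (destruct Hab as [Hab| <-]; [left; now apply exp_increasing|lra]).
  replace (exp b + / exp b) with
    (exp a + / exp a + (exp b - exp a) * (1 - / (exp a * exp b))) by (field; lra).
  assert (/ (exp a * exp b) <= 1) by (rewrite <- Rinv_1; apply Rinv_le_contravar; nra).
  nra. }
destruct (Rle_lt_dec 0 s).
- apply Hm; lra.
- assert (H0 := Hm (- (2 * s)) (2 * t)); rewrite Ropp_involutive in H0; lra.
Qed.

Lemma is_RInt_weight (s : R) :
  is_RInt weight 0 s ((exp (2 * s) - exp (- (2 * s))) / 2).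
Proof.
replace ((exp (2 * s) - exp (- (2 * s))) / 2) with
  (minus ((exp (2 * s) - exp (- (2 * s))) / 2) ((exp (2 * 0) - exp (- (2 * 0))) / 2)).
2:{ unfold minus, plus, opp; simpl; rewrite Rmult_0_r, Ropp_0; lra. }
apply (is_RInt_derive (fun s => (exp (2 * s) - exp (- (2 * s))) / 2)).
- intros x _; unfold weight; auto_derive; trivial; field.
- intros x _; apply (ex_derive_continuous weight); unfold weight; auto_derive; trivial.
Qed.

Lemma RInt_weight_bound (f : R -> R) (B s : R) :
  (forall t, continuous f t) -> (forall t, Rabs (f t) <= B * weight t) ->
  Rabs (RInt f 0 s) <= B / 2 * weight s.
Proof.
intros Hf HB.
assert (Hex : forall a b, ex_RInt f a b) by (intros; apply (ex_RInt_continuous (V := R_CompleteNormedModule)); auto).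
assert (HB0 : 0 <= B).
{ assert (H := HB 0); assert (H1 := Rabs_pos (f 0)); destruct (weight_ge 0); nra. }
assert (Hw : is_RInt (fun t => B * weight t) 0 s (B * ((exp (2 * s) - exp (- (2 * s))) / 2))).
{ apply (is_RInt_scal weight 0 s B), is_RInt_weight. }
assert (He1 := exp_pos (2 * s)); assert (He2 := exp_pos (- (2 * s))).
destruct (Rle_lt_dec 0 s) as [Hs|Hs].
- apply Rle_trans with (B * ((exp (2 * s) - exp (- (2 * s))) / 2)); [|unfold weight; nra].
  refine (norm_RInt_le f (fun t => B * weight t) 0 s _ _ Hs (fun t _ => HB t) _ Hw).
  apply (RInt_correct f), Hex.
- apply Rle_trans with (- (B * ((exp (2 * s) - exp (- (2 * s))) / 2))); [|unfold weight; nra].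
  rewrite <- (opp_RInt_swap f) by apply Hex.
  change (Rabs (- RInt f s 0) <= - (B * ((exp (2 * s) - exp (- (2 * s))) / 2))).
  rewrite Rabs_Ropp.
  refine (norm_RInt_le f (fun t => B * weight t) s 0 _ _ _ (fun t _ => HB t) _ _); [lra| |].
  + apply (RInt_correct f), Hex.
  + now apply (is_RInt_swap (fun t => B * weight t)).
Qed.

Fixpoint picard (g : R -> R) (k : R) (n : nat) (s : R) : R :=
  match n with
  | O => k
  | S m => k + RInt (fun t => Rabs (picard g k m t) + g t) 0 s
  end.

Lemma continuous_Rabs_plus (f g : R -> R) (t : R) :
  continuous f t -> continuous g t -> continuous (fun t => Rabs (f t) + g t) t.
Proof.
intros Hf Hg; apply (continuous_plus (fun t => Rabs (f t)) g); trivial.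
apply (continuous_comp f Rabs); trivial. apply continuous_Rabs.
Qed.

Lemma is_derive_integral (f g : R -> R) (k s : R) :
  (forall t, continuous f t) -> (forall t, continuous g t) ->
  is_derive (fun s => k + RInt (fun t => Rabs (f t) + g t) 0 s) s (Rabs (f s) + g s).
Proof.
intros Hf Hg.
assert (Hc : forall t, continuous (fun t => Rabs (f t) + g t) t)
  by (intros; now apply continuous_Rabs_plus).
replace (Rabs (f s) + g s) with (plus 0 (Rabs (f s) + g s)) by (unfold plus; simpl; ring).
apply (is_derive_plus (fun _ => k)). apply (is_derive_const k).
apply (is_derive_RInt (fun t => Rabs (f t) + g t) _ 0); [|apply Hc].
apply filter_forall; intros t; apply (RInt_correct (fun t => Rabs (f t) + g t)).
apply (ex_RInt_continuous (V := R_CompleteNormedModule)); auto.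
Qed.

Section Picard.
Variables (g : R -> R) (k G : R).
Hypothesis g_cont : forall t, continuous g t.
Hypothesis g_bound : forall t, Rabs (g t) <= G * weight t.

Lemma picard_continuous (n : nat) (t : R) : continuous (picard g k n) t.
Proof.
revert t; induction n as [|n IH]; intros t.
- apply continuous_const.
- apply (ex_derive_continuous (picard g k (S n))).
  eexists; simpl; now apply is_derive_integral.
Qed.

(** [A * weight] dominates the integrand [|k| + g] of the first Picard step and sets the scale of
    the geometric series. *)
Let A := Rabs k + G.

(** The contraction estimate: [g] cancels, the modulus is 1-Lipschitz, and integration halves the
    weighted bound. *)
Lemma integral_diff_bound (f1 f2 : R -> R) (B s : R) :
  (forall t, continuous f1 t) -> (forall t, continuous f2 t) ->
  (forall t, Rabs (f1 t - f2 t) <= B * weight t) ->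
  Rabs ((k + RInt (fun t => Rabs (f1 t) + g t) 0 s) -
        (k + RInt (fun t => Rabs (f2 t) + g t) 0 s)) <= B / 2 * weight s.
Proof.
intros H1 H2 HB.
assert (Hc1 : forall t, continuous (fun t => Rabs (f1 t) + g t) t)
  by (intros; now apply continuous_Rabs_plus).
assert (Hc2 : forall t, continuous (fun t => Rabs (f2 t) + g t) t)
  by (intros; now apply continuous_Rabs_plus).
replace (_ - _) with
  (RInt (fun t => minus (Rabs (f1 t) + g t) (Rabs (f2 t) + g t)) 0 s).
- apply RInt_weight_bound.
  + intros t; now apply (continuous_minus (fun t => Rabs (f1 t) + g t)).
  + intros t; unfold minus, plus, opp; simpl.
    replace (Rabs (f1 t) + g t + - (Rabs (f2 t) + g t)) with (Rabs (f1 t) - Rabs (f2 t)) by Rring.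
    eapply Rle_trans; [apply Rabs_triang_inv2|apply HB].
- rewrite (RInt_minus (fun t => Rabs (f1 t) + g t) (fun t => Rabs (f2 t) + g t));
    [|apply (ex_RInt_continuous (V := R_CompleteNormedModule)); auto ..].
  unfold minus, plus, opp; simpl; Rring.
Qed.

Lemma picard_step (n : nat) (s : R) :
  Rabs (picard g k (S n) s - picard g k n s) <= A * (/ 2) ^ n * weight s.
Proof.
revert s; induction n as [|n IH]; intros s.
- simpl; rewrite Rplus_minus_l.
  assert (HA : forall t, Rabs (Rabs k + g t) <= A * weight t).
  { intros t; eapply Rle_trans; [apply Rabs_triang|]; rewrite Rabs_Rabsolu.
    unfold A; specialize (g_bound t); destruct (weight_ge t).
    assert (H1 := Rabs_pos k); nra. }
  assert (H := RInt_weight_bound (fun t => Rabs k + g t) A s).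
  apply Rle_trans with (A / 2 * weight s).
  + apply H; trivial; intros t.
    apply (continuous_Rabs_plus (fun _ => k)); trivial; apply continuous_const.
  + assert (H1 := HA s); assert (H2 := Rabs_pos (Rabs k + g s)); nra.
- simpl pow; replace (A * (/ 2 * (/ 2) ^ n)) with (A * (/ 2) ^ n / 2) by field.
  apply (integral_diff_bound (picard g k (S n)) (picard g k n));
    trivial; apply picard_continuous.
Qed.

(** Telescoping; [2 - 2 (1/2)^m] is the sum of the first [m] powers of [1/2], starting with 1. *)
Lemma picard_cauchy (n m : nat) (s : R) :
  Rabs (picard g k (n + m) s - picard g k n s) <=
    (2 - 2 * (/ 2) ^ m) * (A * (/ 2) ^ n * weight s).
Proof.
induction m as [|m IH].
- rewrite Nat.add_0_r, Rminus_diag, Rabs_R0; simpl; lra.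
- rewrite Nat.add_succ_r.
  assert (H := picard_step (n + m) s); rewrite pow_add in H.
  replace (picard g k (S (n + m)) s - picard g k n s) with
    ((picard g k (S (n + m)) s - picard g k (n + m) s) +
     (picard g k (n + m) s - picard g k n s)) by Rring.
  eapply Rle_trans; [apply Rabs_triang|]; simpl pow; nra.
Qed.

Lemma picard_bound_nonneg (n : nat) (s : R) : 0 <= A * (/ 2) ^ n * weight s.
Proof. eapply Rle_trans; [apply Rabs_pos|apply picard_step]. Qed.

Lemma geometric_small (B : R) (e : posreal) :
  exists n, forall m, (n <= m)%nat -> B * (/ 2) ^ m < e.
Proof.
assert (H : is_lim_seq (fun n => B * (/ 2) ^ n) (B * 0)).
{ apply (is_lim_seq_scal_l _ B 0), is_lim_seq_geom; rewrite Rabs_right; lra. }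
apply is_lim_seq_spec in H; destruct (H e) as [n Hn].
exists n; intros m Hm; specialize (Hn m Hm).
apply Rabs_lt_between in Hn; lra.
Qed.

Let L (s : R) : R := real (Lim_seq (fun n => picard g k n s)).

Lemma picard_lim (s : R) : is_lim_seq (fun n => picard g k n s) (L s).
Proof.
apply Lim_seq_correct', ex_lim_seq_cauchy_corr; intros e.
destruct (geometric_small (4 * (A * weight s)) e) as [n Hn].
exists n; intros p q Hp Hq.
assert (H : forall m, (n <= m)%nat ->
  Rabs (picard g k m s - picard g k n s) <= 2 * (A * weight s) * (/ 2) ^ n).
{ intros m Hm; replace m with (n + (m - n))%nat by lia.
  eapply Rle_trans; [apply picard_cauchy|].
  assert (H1 := picard_bound_nonneg n s).
  assert (H2 : 0 < (/ 2) ^ (m - n)) by (apply pow_lt; lra); nra. }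
replace (picard g k p s - picard g k q s) with
  ((picard g k p s - picard g k n s) - (picard g k q s - picard g k n s)) by Rring.
specialize (Hn n (Nat.le_refl n)).
assert (Ha := H p Hp); assert (Hb := H q Hq).
apply Rabs_le_between in Ha; apply Rabs_le_between in Hb; apply Rabs_lt_between; lra.
Qed.

Lemma picard_lim_bound (n : nat) (s : R) :
  Rabs (picard g k n s - L s) <= 2 * A * (/ 2) ^ n * weight s.
Proof.
assert (H : Rbar_le (Rabs (L s - picard g k n s)) (2 * A * (/ 2) ^ n * weight s)).
{ apply is_lim_seq_le with
    (fun m => Rabs (picard g k (n + m) s - picard g k n s))
    (fun _ => 2 * A * (/ 2) ^ n * weight s).
  - intros m; eapply Rle_trans; [apply picard_cauchy|].
    assert (H1 := picard_bound_nonneg n s).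
    assert (H2 : 0 < (/ 2) ^ m) by (apply pow_lt; lra); nra.
  - apply (is_lim_seq_abs _ (L s - picard g k n s)).
    apply is_lim_seq_minus'; [|apply is_lim_seq_const].
    apply (is_lim_seq_ext (fun m => picard g k (m + n) s)).
    + intros m; now rewrite Nat.add_comm.
    + apply (is_lim_seq_incr_n (fun m => picard g k m s)), picard_lim.
  - apply is_lim_seq_const. }
now rewrite Rabs_minus_sym.
Qed.

(** Convergence is uniform on the ball of radius 1 about [t], since the weight is at most
    [weight (|t| + 1)] there. *)
Lemma picard_lim_continuous (t : R) : continuous L t.
Proof.
apply continuity_pt_filterlim.
apply (CVU_continuity (picard g k) L t (mkposreal 1 Rlt_0_1)).
- intros e He.
  destruct (geometric_small (2 * A * weight (Rabs t + 1)) (mkposreal e He)) as [n Hn].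
  exists n; intros m y Hm Hy; unfold Boule in Hy; simpl in Hy.
  rewrite Rabs_minus_sym.
  eapply Rle_lt_trans; [apply picard_lim_bound|].
  eapply Rle_lt_trans; [|apply (Hn m Hm)].
  assert (Hw : weight y <= weight (Rabs t + 1)).
  { apply weight_mono. replace y with (t + (y - t)) by Rring.
    eapply Rle_trans; [apply Rabs_triang|]; lra. }
  assert (H1 := picard_bound_nonneg m 0); destruct (weight_ge 0).
  assert (0 <= A * (/ 2) ^ m) by nra. nra.
- intros n y _; apply continuity_pt_filterlim, picard_continuous.
- unfold Boule; simpl; rewrite Rminus_diag, Rabs_R0; lra.
Qed.

(** By the contraction estimate the shifted iterates also converge to the right-hand side; limits
    are unique. *)
Lemma picard_lim_integral (s : R) : L s = k + RInt (fun t => Rabs (L t) + g t) 0 s.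
Proof.
set (v := k + _).
enough (Hv : is_lim_seq (fun n => picard g k (S n) s) v).
{ assert (HL := picard_lim s); apply (is_lim_seq_incr_1 (fun n => picard g k n s)) in HL.
  apply is_lim_seq_unique in HL; apply is_lim_seq_unique in Hv.
  rewrite Hv in HL; now injection HL. }
apply is_lim_seq_spec; intros e.
destruct (geometric_small (2 * A / 2 * weight s) e) as [n Hn].
exists n; intros m Hm; specialize (Hn m Hm).
eapply Rle_lt_trans; [|exact Hn].
apply Rle_trans with (2 * A * (/ 2) ^ m / 2 * weight s); [|apply Req_le; field].
apply (integral_diff_bound (picard g k m) L).
- apply picard_continuous.
- apply picard_lim_continuous.
- apply picard_lim_bound.
Qed.

Lemma picard_solution :
  exists eta : R -> R, eta 0 = k /\ forall s, is_derive eta s (Rabs (eta s) + g s).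
Proof.
exists L; split.
- rewrite picard_lim_integral, RInt_point; unfold zero; simpl; Rring.
- intros s; eapply is_derive_ext; [intros t; symmetry; apply picard_lim_integral|].
  apply is_derive_integral; trivial; apply picard_lim_continuous.
Qed.

End Picard.

Lemma scaled_solution_exists (lam t0 k : R) :
  exists eta : R -> R, scaled_solution lam eta /\ eta t0 = k.
Proof.
(* Time is shifted so that the initial condition sits at 0; the forcing term grows linearly and is
   dominated by the weight. *)
destruct (picard_solution (fun t => lam - Rabs (t + t0)) k (Rabs lam + 1 + Rabs t0))
  as [eta [H0 Heta]].
- intros t; apply (continuous_minus (fun _ => lam) (fun t => Rabs (t + t0))).
  apply continuous_const.
  apply (continuous_comp (fun t => t + t0) Rabs); [|apply continuous_Rabs].
  apply (continuous_plus (fun t => t) (fun _ => t0)); [apply continuous_id|apply continuous_const].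
- intros t; destruct (weight_ge t) as [H1 H2].
  unfold Rminus; eapply Rle_trans; [apply Rabs_triang|]; rewrite Rabs_Ropp, Rabs_Rabsolu.
  assert (H3 := Rabs_triang t t0); assert (H4 := Rabs_pos lam); assert (H5 := Rabs_pos t0).
  nra.
- exists (fun s => eta (s - t0)); split; [|now rewrite Rminus_diag].
  intros s; specialize (Heta (s - t0)).
  replace (s - t0 + t0) with s in Heta by Rring.
  auto_derive; [eexists; exact Heta|]; derive_value Heta; ring.
Qed.

(** * Scaled orbits and the entry section *)

Lemma scaled_solution_lift (lam eps y0 : R) (eta : R -> R) : 0 < eps ->
  scaled_solution lam eta ->
  is_solution lam eps (fun t => eps * eta (y0 / eps + t)) (fun t => y0 + eps * t).
Proof.
intros Heps Heta t; split.
- assert (H := Heta (y0 / eps + t)).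
  auto_derive; [now eexists; exact H|]; derive_value H.
  replace (y0 + eps * t) with (eps * (y0 / eps + t)) by (field; lra).
  rewrite !Rabs_mult, (Rabs_right eps) by lra; ring.
- auto_derive; trivial; ring.
Qed.

(** [y] must be affine, so [y / eps] can serve as time; in that time [x / eps] solves the scaled
    equation and uniqueness applies. *)
Lemma solution_scaled (lam eps : R) (x y eta : R -> R) : 0 < eps ->
  is_solution lam eps x y -> scaled_solution lam eta ->
  x 0 = eps * eta (y 0 / eps) ->
  forall t, y t = y 0 + eps * t /\ x t = eps * eta (y t / eps).
Proof.
intros Heps Hsol Heta H0.
assert (Hy : forall t, y t = y 0 + eps * t).
{ intros t.
  assert (H : Rabs (y t - (y 0 + eps * t)) <=
    Rabs (y 0 - (y 0 + eps * 0)) * exp (Rabs (t - 0))).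
  { apply (gronwall (fun t => y t - (y 0 + eps * t)) (fun _ => 0)).
    - intros u _; destruct (Hsol u) as [_ Hu].
      auto_derive; [now eexists; exact Hu|]; derive_value Hu; ring.
    - intros u _; rewrite Rabs_R0; apply Rabs_pos. }
  replace (y 0 - (y 0 + eps * 0)) with 0 in H by ring.
  rewrite Rabs_R0, Rmult_0_l in H; assert (H1 := Rabs_pos (y t - (y 0 + eps * t))).
  destruct (Req_dec (y t - (y 0 + eps * t)) 0) as [E|E]; [lra|].
  apply Rabs_pos_lt in E; lra. }
assert (Hz : scaled_solution lam (fun s => x (s - y 0 / eps) / eps)).
{ intros s; destruct (Hsol (s - y 0 / eps)) as [Hx _].
  auto_derive; [now eexists; exact Hx|]; derive_value Hx.
  rewrite (Hy (s - y 0 / eps)); replace (y 0 + eps * (s - y 0 / eps)) with (eps * s) by (field; lra).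
  unfold Rdiv, Rminus; rewrite !Rabs_mult, Rabs_inv, (Rabs_right eps) by lra; field; lra. }
intros t; split; [apply Hy|].
assert (H := solves_unique lam eta (fun s => x (s - y 0 / eps) / eps) (y t / eps) (y 0 / eps)).
simpl in H; rewrite H; trivial.
- rewrite (Hy t); replace ((y 0 + eps * t) / eps - y 0 / eps) with t by (field; lra); field; lra.
- intros u _; apply Hz.
- rewrite Rminus_diag, H0; field; lra.
Qed.

(** As [y] runs through the whole line at constant speed, the orbit is a complete graph over [y]. *)
Lemma orbit_scaled (lam eps x0 y0 : R) (eta : R -> R) (q : R * R) : 0 < eps ->
  scaled_solution lam eta -> x0 = eps * eta (y0 / eps) ->
  orbit lam eps (x0, y0) q <-> fst q = eps * eta (snd q / eps).
Proof.
intros Heps Heta H0; split.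
- intros (x & y & Hsol & Hi & t & <-); injection Hi as <- <-; simpl.
  now apply (solution_scaled lam eps x y eta).
- destruct q as [x1 y1]; simpl; intros ->.
  exists (fun t => eps * eta (y0 / eps + t)), (fun t => y0 + eps * t).
  split; [now apply scaled_solution_lift|split].
  + rewrite Rplus_0_r, H0; f_equal; ring.
  + exists ((y1 - y0) / eps); f_equal; [f_equal; f_equal|]; field; lra.
Qed.

Lemma forward_orbit_scaled (lam eps x0 y0 : R) (eta : R -> R) (q : R * R) : 0 < eps ->
  scaled_solution lam eta -> x0 = eps * eta (y0 / eps) ->
  forward_orbit lam eps (x0, y0) q <-> y0 <= snd q /\ fst q = eps * eta (snd q / eps).
Proof.
intros Heps Heta H0; split.
- intros (x & y & Hsol & Hi & t & Ht & <-); injection Hi as <- <-; simpl.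
  destruct (solution_scaled lam eps x y eta Heps Hsol Heta H0 t) as [Hy Hx].
  split; trivial; nra.
- destruct q as [x1 y1]; simpl; intros [Hy ->].
  exists (fun t => eps * eta (y0 / eps + t)), (fun t => y0 + eps * t).
  split; [now apply scaled_solution_lift|split].
  + rewrite Rplus_0_r, H0; f_equal; ring.
  + exists ((y1 - y0) / eps); split.
    * apply Rmult_le_pos; [lra|left; now apply Rinv_0_lt_compat].
    * f_equal; [f_equal; f_equal|]; field; lra.
Qed.

Lemma flow_sig (lam k : R) :
  { eta : R -> R | scaled_solution lam eta /\ eta (- lam) = k }.
Proof. apply constructive_indefinite_description, scaled_solution_exists. Qed.

(** Solutions are labelled by their value at [s = - lam], where the entry phase ends. The line
    [s - 1 + lam] of the slow manifold has the value [- 1] there, so [k = - 1] labels its orbit. *)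
Definition flow (lam k : R) : R -> R := proj1_sig (flow_sig lam k).

Lemma flow_solution (lam k : R) : scaled_solution lam (flow lam k).
Proof. exact (proj1 (proj2_sig (flow_sig lam k))). Qed.

Lemma flow_start (lam k : R) : flow lam k (- lam) = k.
Proof. exact (proj2 (proj2_sig (flow_sig lam k))). Qed.

(* The value at [s = - lam] of the solution that starts on the entry section
   [eta = - N] at [s = - N + 1 - lam + P]; here [P] is [r / eps]. *)
Definition entry_value (N P : R) : R := - 1 - P * exp (- (N - P - 1)).

Lemma exp_le (a b : R) : a <= b -> exp a <= exp b.
Proof. intros [H| ->]; [left; now apply exp_increasing|apply Rle_refl]. Qed.

Lemma exp_neg_le_inv (x : R) : 0 < x -> exp (- x) <= / x.
Proof.
intros Hx; rewrite exp_Ropp; apply Rinv_le_contravar; trivial.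
assert (H := exp_ineq1_le x); lra.
Qed.

(** The expression solves [eta' = - eta + s + lam], which is the scaled equation as long as it is
    nonpositive. For [P <= 0] and elapsed time up to [N], bounding the exponential by 1 suffices;
    later the correction is at most 1, while the line is at most [- 1]. *)
Lemma entry_nonpos (lam N P s : R) : 2 <= N -> Rabs P <= N / 2 ->
  - N + 1 - lam + P <= s <= - lam ->
  s - 1 + lam - P * exp (- (s - (- N + 1 - lam + P))) <= 0.
Proof.
intros HN HR Hs; apply Rabs_le_between in HR.
set (t := s - (- N + 1 - lam + P)).
assert (Ht : 0 <= t) by (unfold t; lra).
assert (He := exp_pos (- t)).
assert (He1 : exp (- t) <= 1) by (rewrite <- exp_0; apply exp_le; lra).
destruct (Rle_lt_dec 0 P) as [HR0|HR0]; [nra|].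
destruct (Rle_lt_dec t N) as [HtN|HtN].
- replace (s - 1 + lam) with (- N + P + t) by (unfold t; ring); nra.
- assert (exp (- t) <= / N).
  { eapply Rle_trans; [|apply exp_neg_le_inv; lra]; apply exp_le; lra. }
  assert (Hi : N * / N = 1) by (field; lra).
  assert (- P * exp (- t) <= N * / N) by (apply Rmult_le_compat; lra). lra.
Qed.

(** The closed formula agrees with [eta] at [- lam] by the choice of [entry_value]; uniqueness
    carries this back to the entry section. *)
Lemma entry (lam N P : R) (eta : R -> R) : 0 < lam -> 2 <= N -> Rabs P <= N / 2 ->
  scaled_solution lam eta -> eta (- lam) = entry_value N P ->
  eta (- N + 1 - lam + P) = - N /\
  forall s, - N + 1 - lam + P <= s <= - lam -> eta s <= 0.
Proof.
intros Hlam HN HR Heta H0.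
set (s0 := - N + 1 - lam + P).
assert (Hs0 : s0 <= - lam) by (apply Rabs_le_between in HR; unfold s0; lra).
assert (Heq : forall s, s0 <= s <= - lam -> eta s = s - 1 + lam - P * exp (- (s - s0))).
{ intros s Hs.
  apply (solves_unique lam eta (fun s => s - 1 + lam - P * exp (- (s - s0))) s (- lam)); trivial.
  - intros u Hu; rewrite Rmin_left, Rmax_right in Hu by lra.
    unfold solves_at; rewrite (Rabs_left1 (u - _ + _ - _)), (Rabs_left1 u); [|lra|].
    + auto_derive; trivial; unfold Rminus; ring.
    + apply entry_nonpos; trivial; unfold s0 in *; lra.
  - rewrite H0; unfold entry_value, s0.
    replace (- (- lam - (- N + 1 - lam + P))) with (- (N - P - 1)) by ring; ring. }
split.
- rewrite Heq by lra; rewrite Rminus_diag, Ropp_0, exp_0; unfold s0; ring.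
- intros s Hs; rewrite Heq by trivial; now apply entry_nonpos.
Qed.

(** The exponent satisfies [N - P - 1 >= N / 2 - 1]. The shift costs [exp 1 <= 3]; of the two
    factors [exp (- N / 4)] one absorbs the prefactor [N / 2]. *)
Lemma entry_value_bound (N P : R) : 2 <= N -> Rabs P <= N / 2 ->
  Rabs (entry_value N P + 1) <= 6 * exp (- (N / 4)).
Proof.
intros HN HR; unfold entry_value.
replace (- 1 - P * exp (- (N - P - 1)) + 1) with (- (P * exp (- (N - P - 1)))) by ring.
rewrite Rabs_Ropp, Rabs_mult, (Rabs_right (exp _)) by (left; apply exp_pos).
assert (HR' := HR); apply Rabs_le_between in HR'.
assert (H1 : exp (- (N - P - 1)) <= 3 * (exp (- (N / 4)) * exp (- (N / 4)))).
{ apply Rle_trans with (exp 1 * (exp (- (N / 4)) * exp (- (N / 4)))).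
  - rewrite <- !exp_plus; apply exp_le; lra.
  - apply Rmult_le_compat_r; [|apply exp_le_3].
    assert (H := exp_pos (- (N / 4))); nra. }
assert (H2 : exp (- (N / 4)) <= / (N / 4)) by (apply exp_neg_le_inv; lra).
assert (H3 := exp_pos (- (N / 4))); assert (H4 := exp_pos (- (N - P - 1))).
assert (H5 : N * exp (- (N / 4)) <= 4).
{ apply Rle_trans with (N * / (N / 4)); [apply Rmult_le_compat_l; lra|].
  apply Req_le; field; lra. }
assert (H6 := Rabs_pos P).
apply Rle_trans with (N / 2 * (3 * (exp (- (N / 4)) * exp (- (N / 4))))); [|nra].
apply Rmult_le_compat; lra.
Qed.

(** By Gronwall the flow is Lipschitz in [k] with constant [exp |s + lam|]. *)
Lemma flow_entry_continuous (lam N s : R) :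
  continuity (fun P => flow lam (entry_value N P) s).
Proof.
assert (Hk : forall P, continuous (entry_value N) P).
{ intros P; apply (ex_derive_continuous (entry_value N)); unfold entry_value; auto_derive; trivial. }
intros P; apply continuity_pt_filterlim.
apply (continuous_comp (entry_value N) (fun k => flow lam k s)); [apply Hk|].
generalize (entry_value N P); intros k; apply continuity_pt_filterlim.
intros e He; set (E := exp (Rabs (s + lam))).
assert (HE : 0 < E) by apply exp_pos.
exists (e / E); split; [now apply Rdiv_lt_0_compat|].
intros k' [_ Hk']; simpl in *; unfold Rdist in *.
eapply Rle_lt_trans; [apply (scaled_solution_dependence lam _ _ s (- lam)); apply flow_solution|].
rewrite !flow_start; unfold Rminus at 2; rewrite Ropp_involutive; fold E.
replace e with (e / E * E) by (field; lra).
now apply Rmult_lt_compat_r.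
Qed.

Lemma entry_IVT (lam N s v Ra Rb : R) :
  v <= flow lam (entry_value N Ra) s -> flow lam (entry_value N Rb) s <= v ->
  exists P, Rmin Ra Rb <= P <= Rmax Ra Rb /\ flow lam (entry_value N P) s = v.
Proof.
intros Ha Hb.
destruct (IVT_gen (fun P => flow lam (entry_value N P) s) Ra Rb v) as [P HR].
- apply flow_entry_continuous.
- rewrite Rmin_right, Rmax_left by lra; lra.
- now exists P.
Qed.

Lemma delta_in_forward_orbit (rho lam eps r : R) (q : R * R) :
  0 < lam -> 0 < eps -> 2 <= rho / eps -> Rabs r <= rho / 2 ->
  forward_orbit lam eps (- rho, - rho + eps * (1 - lam) + r) q <->
  - rho + eps * (1 - lam) + r <= snd q /\
  fst q = eps * flow lam (entry_value (rho / eps) (r / eps)) (snd q / eps).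
Proof.
intros Hlam Heps HN Hr.
apply forward_orbit_scaled; [trivial|apply flow_solution|].
replace ((- rho + eps * (1 - lam) + r) / eps) with
  (- (rho / eps) + 1 - lam + r / eps) by (field; lra).
destruct (entry lam (rho / eps) (r / eps) (flow lam (entry_value (rho / eps) (r / eps))))
  as [-> _]; trivial; [|apply flow_solution|apply flow_start|field; lra].
unfold Rdiv; rewrite Rabs_mult, Rabs_inv, (Rabs_right eps) by lra.
replace (rho * / eps * / 2) with (rho / 2 * / eps) by (field; lra).
apply Rmult_le_compat_r; trivial; left; now apply Rinv_0_lt_compat.
Qed.

(** * Behaviour after the entry phase *)

Lemma flow_close (lam k s : R) :
  Rabs (flow lam k s - flow lam (- 1) s) <= Rabs (k + 1) * exp (Rabs (s + lam)).
Proof.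
assert (H := scaled_solution_dependence lam (flow lam k) (flow lam (- 1)) s (- lam)
  (flow_solution _ _) (flow_solution _ _)).
rewrite !flow_start in H.
replace (k - - 1) with (k + 1) in H by ring; now replace (s - - lam) with (s + lam) in H by ring.
Qed.

(* For [lam > 1] the line [s - 1 + lam], which carries the attracting slow
   manifold for [s <= 1 - lam], is a subsolution up to [s = 0]. *)
Lemma flow_ge_line (lam : R) : 1 < lam -> lam - 1 <= flow lam (- 1) 0.
Proof.
intros Hlam; replace (lam - 1) with (0 - 1 + lam) by ring.
apply (subsolution_ge lam (flow lam (- 1)) (fun s => s - 1 + lam) (fun _ => 1) (- lam));
  [lra|apply flow_solution| | |rewrite flow_start; lra].
- intros s _; auto_derive; trivial.
- intros s Hs; rewrite (Rabs_left1 s) by lra.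
  destruct (Rle_lt_dec (s - 1 + lam) 0); [rewrite Rabs_left1|rewrite Rabs_right]; lra.
Qed.

(* For [lam < 1] the same line is a supersolution for all [s]. *)
Lemma flow_le_line (lam : R) : 0 < lam < 1 -> flow lam (- 1) 1 <= lam.
Proof.
intros Hlam; replace lam with (1 - 1 + lam) at 2 by ring.
apply (supersolution_le lam (flow lam (- 1)) (fun s => s - 1 + lam) (fun _ => 1) (- lam));
  [lra|apply flow_solution| | |rewrite flow_start; lra].
- intros s _; auto_derive; trivial.
- intros s Hs; assert (H := Rabs_triang s (lam - 1)); rewrite (Rabs_left (lam - 1)) in H by lra.
  replace (s - 1 + lam) with (s + (lam - 1)) by ring; lra.
Qed.

(* The coefficient of [exp s] in the solution for [s >= 0], see [flow_right]. *)
Definition growth_coeff (lam k : R) : R := flow lam k 0 + lam - 1.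

Lemma growth_coeff_close (lam k : R) : 0 < lam ->
  Rabs (growth_coeff lam k - growth_coeff lam (- 1)) <= Rabs (k + 1) * exp lam.
Proof.
intros Hlam; unfold growth_coeff.
replace (flow lam k 0 + lam - 1 - (flow lam (- 1) 0 + lam - 1)) with
  (flow lam k 0 - flow lam (- 1) 0) by ring.
eapply Rle_trans; [apply flow_close|]; rewrite Rplus_0_l, (Rabs_right lam) by lra; lra.
Qed.

Lemma growth_coeff_ge (lam k : R) : 1 < lam -> Rabs (k + 1) * exp lam <= lam - 1 ->
  lam - 1 <= growth_coeff lam k.
Proof.
intros Hlam Hk; assert (H := growth_coeff_close lam k ltac:(lra)).
apply Rabs_le_between in H; unfold growth_coeff in *.
assert (H1 := flow_ge_line lam Hlam); lra.
Qed.

Lemma flow_right (lam k s : R) : 1 < lam -> lam - 1 <= growth_coeff lam k -> 0 <= s ->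
  flow lam k s = s + 1 - lam + growth_coeff lam k * exp s.
Proof.
intros Hlam Hw Hs; set (w := growth_coeff lam k) in *.
apply (solves_unique lam (flow lam k) (fun s => s + 1 - lam + w * exp s) s 0).
- apply flow_solution.
- intros u Hu; rewrite Rmin_right, Rmax_left in Hu by lra.
  (* [exp u >= 1 + u] and [w >= lam - 1] make the formula at least [lam * u >= 0], so it stays in
     the quadrant where it is a solution. *)
  assert (He := exp_ineq1_le u).
  unfold solves_at; rewrite (Rabs_right u), Rabs_right by (try lra; nra).
  auto_derive; trivial; ring.
- unfold w, growth_coeff; rewrite exp_0; ring.
Qed.

(** The supersolution solves [beta' = beta + lam] and starts at 1. The bound is free of [N], so for
    large [N] the level [eta = N] is not reached while [- lam <= s <= 0]. *)
Lemma flow_mid_bound (lam k s : R) : 0 < lam -> k <= 0 -> - lam <= s <= 0 ->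
  flow lam k s <= (1 + lam) * exp lam.
Proof.
intros Hlam Hk Hs.
assert (He : forall u, - lam <= u -> 1 <= exp (u + lam)).
{ intros u Hu; rewrite <- exp_0; apply exp_le; lra. }
apply Rle_trans with ((1 + lam) * exp (s + lam) - lam).
- apply (supersolution_le lam (flow lam k) (fun s => (1 + lam) * exp (s + lam) - lam)
    (fun s => (1 + lam) * exp (s + lam)) (- lam)); [lra|apply flow_solution| | |].
  + intros u _; auto_derive; trivial; ring.
  + intros u Hu; specialize (He u ltac:(lra)).
    assert (H := Rabs_pos u); rewrite Rabs_right by nra; lra.
  + rewrite flow_start; replace (- lam + lam) with 0 by ring; rewrite exp_0; lra.
- assert (exp (s + lam) <= exp lam) by (apply exp_le; lra); nra.
Qed.

(** If [s <= t], then [v exp (t - s) <= w], and [exp (t - s) >= 1 + (t - s)] gives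
    [v (t - s) <= w - v]; the other case is symmetric. For [w = v] this is uniqueness of the
    crossing. *)
Lemma right_crossing_close (om w v s t : R) : 0 < om -> om <= w -> om <= v ->
  s + w * exp s = t + v * exp t -> Rabs (s - t) <= Rabs (w - v) / om.
Proof.
intros Hom.
assert (Hwlog : forall w v s t, om <= w -> om <= v -> s <= t ->
  s + w * exp s = t + v * exp t -> t - s <= Rabs (w - v) / om).
{ clear -Hom; intros w v s t Hw Hv Hst H; assert (He := exp_pos s).
  assert (H1 : exp t = exp (t - s) * exp s) by (rewrite <- exp_plus; f_equal; ring).
  assert (H2 := exp_ineq1_le (t - s)).
  assert (H3 : v * exp (t - s) <= w).
  { apply Rmult_le_reg_r with (exp s); trivial; rewrite Rmult_assoc, <- H1; lra. }
  assert (H4 := Rle_abs (w - v)); apply Rle_div_r; [lra|]; nra. }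
intros Hw Hv H; destruct (Rle_lt_dec s t) as [Hst|Hst].
- rewrite Rabs_left1 by lra; specialize (Hwlog w v s t Hw Hv Hst H); lra.
- rewrite Rabs_right by lra; rewrite Rabs_minus_sym.
  apply (Hwlog v w t s); lra.
Qed.

(* [N] and [D] stand for [rho / eps] and [delta / eps]. *)
Lemma right_crossing (lam k N D : R) : 1 < lam -> Rabs (k + 1) * exp lam <= lam - 1 ->
  (1 + lam) * exp lam < N -> N + lam < (lam - 1) * exp D -> 0 < D ->
  exists s, 0 <= s < D /\ s + growth_coeff lam k * exp s = N - 1 + lam /\
    forall u, - lam <= u -> (flow lam k u = N <-> u = s).
Proof.
intros Hlam Hk HN HD HD0.
assert (Hw := growth_coeff_ge lam k Hlam Hk).
assert (Hk0 : k <= 0).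
{ assert (H := exp_ineq1_le lam); apply Rnot_lt_le; intros Hk0.
  assert (lam - 1 < Rabs (k + 1) * exp lam); [|lra].
  rewrite Rabs_right by lra; nra. }
assert (H0 : growth_coeff lam k < N - 1 + lam).
{ unfold growth_coeff; assert (H := flow_mid_bound lam k 0 ltac:(lra) Hk0 ltac:(lra)); lra. }
destruct (IVT_gen (fun s => s + growth_coeff lam k * exp s) 0 D (N - 1 + lam)) as [s [Hs Heq]].
- intros s; apply continuity_pt_filterlim.
  apply (ex_derive_continuous (fun s => s + growth_coeff lam k * exp s)); auto_derive; trivial.
- rewrite exp_0, Rplus_0_l, Rmult_1_r.
  assert (H := exp_pos D).
  rewrite Rmin_left, Rmax_right by nra; nra.
- rewrite Rmin_left, Rmax_right in Hs by lra.
  assert (HsD : s < D).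
  { destruct (Req_dec s D) as [->|]; [|lra]; assert (H := exp_pos D); nra. }
  exists s; split; [lra|split; trivial].
  intros u Hu; split.
  + intros Hfu; destruct (Rle_lt_dec 0 u) as [Hu0|Hu0].
    * rewrite flow_right in Hfu by lra.
      assert (H : Rabs (u - s) <= Rabs (growth_coeff lam k - growth_coeff lam k) / (lam - 1))
        by (apply right_crossing_close; lra).
      rewrite Rminus_diag, Rabs_R0 in H; unfold Rdiv in H; rewrite Rmult_0_l in H.
      apply Rabs_le_between in H; lra.
    * assert (H := flow_mid_bound lam k u ltac:(lra) Hk0 ltac:(lra)); lra.
  + intros ->; rewrite flow_right by lra; lra.
Qed.

(* The orbit of the endpoint of the slow manifold is [flow lam (- 1)]. *)
Lemma flow_slow_manifold (lam s : R) : 0 < lam -> s <= Rmin 0 (1 - lam) ->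
  flow lam (- 1) s = s - 1 + lam.
Proof.
intros Hlam Hs; assert (Hm := Rmin_l 0 (1 - lam)); assert (Hm' := Rmin_r 0 (1 - lam)).
apply (solves_unique lam (flow lam (- 1)) (fun s => s - 1 + lam) s (- lam)).
- apply flow_solution.
- intros u [_ Hu].
  assert (u <= Rmin 0 (1 - lam)).
  { eapply Rle_trans; [exact Hu|]; apply Rmax_lub; trivial; apply Rmin_glb; lra. }
  unfold solves_at; rewrite (Rabs_left1 (u - 1 + lam)), (Rabs_left1 u) by lra.
  auto_derive; trivial; ring.
- rewrite flow_start; ring.
Qed.

(** If it stayed nonnegative, the solution would be [s + 1 - lam + w exp (s - 1)] from [s = 1] on,
    where [flow_le_line] gives [w <= 2 lam - 2 < 0]. *)
Lemma flow_eventually_neg (lam : R) : 0 < lam < 1 ->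
  exists s, 1 <= s /\ flow lam (- 1) s < 0.
Proof.
intros Hlam; apply NNPP; intros Hn.
assert (Hpos : forall s, 1 <= s -> 0 <= flow lam (- 1) s).
{ intros s Hs; apply Rnot_lt_le; intros H; apply Hn; now exists s. }
assert (H1 := flow_le_line lam Hlam).
set (w := flow lam (- 1) 1 - 2 + lam).
assert (Hw : w <= 2 * lam - 2) by (unfold w; lra).
(* With [a = T - 1], so [(1 - lam) a = 3], the bound [exp a >= (1 + a / 2)^2] makes the formula at
   [T] at most [lam - 6 - a / 2 < 0]. *)
set (T := 1 + 3 / (1 - lam)).
assert (HT : 3 / (1 - lam) * (1 - lam) = 3) by (field; lra).
assert (HT0 : 0 < 3 / (1 - lam)) by (apply Rdiv_lt_0_compat; lra).
assert (H : Rabs (flow lam (- 1) T - (T + 1 - lam + w * exp (T - 1))) <=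
  Rabs (flow lam (- 1) 1 - (1 + 1 - lam + w * exp (1 - 1))) * exp (Rabs (T - 1))).
{ apply (gronwall (fun s => flow lam (- 1) s - (s + 1 - lam + w * exp (s - 1)))
    (fun s => flow lam (- 1) s - (s + 1 - lam + w * exp (s - 1)))).
  - intros u Hu; rewrite Rmin_right, Rmax_left in Hu by (unfold T; lra).
    assert (H := flow_solution lam (- 1) u).
    auto_derive; [now eexists; exact H|]; derive_value H.
    rewrite (Rabs_right u), Rabs_right by (try apply Rle_ge, Hpos; lra).
    unfold Rminus; ring.
  - intros; apply Rle_refl. }
rewrite Rminus_diag, exp_0 in H.
replace (flow lam (- 1) 1 - (1 + 1 - lam + w * 1)) with 0 in H by (unfold w; ring).
rewrite Rabs_R0, Rmult_0_l in H; apply Rabs_le_between in H.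
assert (H2 := Hpos T ltac:(unfold T; lra)).
assert (H3 := exp_ineq1_le ((T - 1) / 2)).
assert (H4 : exp (T - 1) = exp ((T - 1) / 2) * exp ((T - 1) / 2))
  by (rewrite <- exp_plus; f_equal; field).
replace (T - 1) with (3 / (1 - lam)) in * by (unfold T; ring).
set (a := 3 / (1 - lam)) in *.
assert (H5 : (1 + a / 2) * (1 + a / 2) <= exp a) by (rewrite H4; apply Rmult_le_compat; lra).
assert (H6 : w * exp a <= (2 * lam - 2) * ((1 + a / 2) * (1 + a / 2))) by nra.
unfold T in *; nra.
Qed.

(** For [k] near [- 1] continuous dependence makes all solutions nonpositive at one common [S];
    afterwards they stay in the quadrant [eta <= 0 <= s], where the equation is linear. *)
Lemma flow_left (lam : R) : 0 < lam < 1 ->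
  exists S Z m, 0 < Z /\ 0 < m /\ forall k, Rabs (k + 1) <= m ->
  exists z, Rabs z <= Z /\ forall s, S <= s ->
    flow lam k s = 1 + lam - s + z * exp (- s).
Proof.
intros Hlam; destruct (flow_eventually_neg lam Hlam) as [S [HS Hneg]].
set (f := flow lam (- 1) S) in *.
assert (HE := exp_pos (S + lam)); assert (HES := exp_pos S).
(* [m] keeps the deviation at [S] below [- f], so the values there lie in [[2 f, 0]]; [Z] bounds the
   coefficients that result. *)
exists S, ((- 2 * f + S + 1 + lam) * exp S), (- f / exp (S + lam)).
split; [apply Rmult_lt_0_compat; lra|split; [apply Rdiv_lt_0_compat; lra|]].
intros k Hk; set (e := flow lam k S).
assert (He : 2 * f <= e <= 0).
{ assert (H := flow_close lam k S); fold e f in H; rewrite (Rabs_right (S + lam)) in H by lra.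
  assert (H1 : Rabs (k + 1) * exp (S + lam) <= - f).
  { apply Rle_trans with (- f / exp (S + lam) * exp (S + lam)).
    - now apply Rmult_le_compat_r; [lra|].
    - apply Req_le; field; lra. }
  apply Rabs_le_between in H; lra. }
exists ((e + S - 1 - lam) * exp S); split.
- rewrite Rabs_mult, (Rabs_right (exp S)) by lra.
  apply Rmult_le_compat_r; [lra|]; apply Rabs_le; lra.
- intros s Hs.
  apply (solves_unique lam (flow lam k)
    (fun s => 1 + lam - s + (e + S - 1 - lam) * exp S * exp (- s)) s S).
  + apply flow_solution.
  + intros u Hu; rewrite Rmin_right, Rmax_left in Hu by lra.
    assert (H1 : exp S * exp (- u) = exp (- (u - S))) by (rewrite <- exp_plus; f_equal; ring).
    assert (H2 := exp_ineq1_le (- (u - S))); assert (H3 := exp_pos (- (u - S))).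
    assert (H4 : exp (- (u - S)) <= 1) by (rewrite <- exp_0; apply exp_le; lra).
    unfold solves_at; rewrite (Rabs_right u) by lra; rewrite Rabs_left1.
    * auto_derive; trivial; ring.
    (* With [E = exp (- (u - S))] the formula is [(1 + lam - S) (1 - E) - (u - S) + e E], where
       [1 + lam - S < 1] and [0 <= 1 - E <= u - S]. *)
    * rewrite Rmult_assoc, H1; nra.
  + rewrite Rmult_assoc, <- exp_plus, Rplus_opp_r, exp_0; unfold e; ring.
Qed.

(* The bound on [Z] makes the exponential term [1 / 2]-Lipschitz on [s >= N / 2]. *)
Lemma left_decreasing (lam z Z N s t : R) : Rabs z <= Z -> Z * exp (- (N / 2)) <= 1 / 2 ->
  N / 2 <= s <= t ->
  (1 + lam - t + z * exp (- t)) + (t - s) / 2 <= 1 + lam - s + z * exp (- s).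
Proof.
intros Hz HZ Hs.
assert (H1 : exp (- t) = exp (- s) * exp (- (t - s))) by (rewrite <- exp_plus; f_equal; ring).
assert (H2 := exp_ineq1_le (- (t - s))).
assert (H3 : exp (- (t - s)) <= 1) by (rewrite <- exp_0; apply exp_le; lra).
assert (H4 : exp (- s) <= exp (- (N / 2))) by (apply exp_le; lra).
assert (H5 := exp_pos (- s)).
assert (H6 : Z * exp (- s) <= 1 / 2).
{ eapply Rle_trans; [|exact HZ]; apply Rmult_le_compat_l; trivial.
  eapply Rle_trans; [apply Rabs_pos|exact Hz]. }
apply Rabs_le_between in Hz; rewrite H1.
assert (H7 : Rabs (z * exp (- s)) <= 1 / 2) by (apply Rabs_le; nra).
apply Rabs_le_between in H7.
assert (z * exp (- s) * (1 - exp (- (t - s))) >= - (1 / 2) * (t - s)) by nra.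
nra.
Qed.

(** The slow manifold crosses at [N + 1 + lam], and the exponential term is exactly the shift of the
    crossing. As it is at most [1 / 2], a bracket of radius 1 suffices; strict decrease gives
    uniqueness. *)
Lemma left_crossing (lam S Z z k N D : R) : 0 < lam ->
  Rabs z <= Z -> (forall s, S <= s -> flow lam k s = 1 + lam - s + z * exp (- s)) ->
  S <= N / 2 -> Z * exp (- (N / 2)) <= 1 / 2 -> 1 < D <= N / 2 ->
  exists s, Rabs (s - (N + 1 + lam)) <= Z * exp (- (N / 2)) /\
    forall u, N / 2 <= u -> (flow lam k u = - N <-> u = s).
Proof.
intros Hlam Hz Hf HS HZ HD.
assert (Hzs : forall s, N / 2 <= s -> Rabs (z * exp (- s)) <= Z * exp (- (N / 2))).
{ intros s Hs; rewrite Rabs_mult, (Rabs_right (exp _)) by (left; apply exp_pos).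
  apply Rmult_le_compat; trivial; [apply Rabs_pos|left; apply exp_pos|apply exp_le; lra]. }
destruct (IVT_gen (fun s => 1 + lam - s + z * exp (- s)) (N + lam) (N + 2 + lam) (- N))
  as [s [Hs Heq]].
- intros s; apply continuity_pt_filterlim.
  apply (ex_derive_continuous (fun s => 1 + lam - s + z * exp (- s))); auto_derive; trivial.
- assert (H1 := Hzs (N + lam) ltac:(lra)); assert (H2 := Hzs (N + 2 + lam) ltac:(lra)).
  apply Rabs_le_between in H1; apply Rabs_le_between in H2.
  rewrite Rmin_right, Rmax_left by lra; lra.
- rewrite Rmin_left, Rmax_right in Hs by lra.
  exists s; split.
  + replace (s - (N + 1 + lam)) with (z * exp (- s)) by lra; apply Hzs; lra.
  + intros u Hu; split; [|intros ->; rewrite Hf; lra].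
    rewrite Hf by lra; intros Hfu.
    destruct (Rle_lt_dec s u).
    * assert (H := left_decreasing lam z Z N s u Hz HZ ltac:(lra)); lra.
    * assert (H := left_decreasing lam z Z N u s Hz HZ ltac:(lra)); lra.
Qed.

(** * Transition maps *)

Definition for_small (P : R -> Prop) : Prop :=
  exists e0 : R, 0 < e0 /\ forall eps : R, 0 < eps <= e0 -> P eps.

Lemma for_small_and (P Q : R -> Prop) :
  for_small P -> for_small Q -> for_small (fun eps => P eps /\ Q eps).
Proof.
intros (a & Ha & HP) (b & Hb & HQ); exists (Rmin a b); split; [now apply Rmin_glb_lt|].
intros eps He; assert (H1 := Rmin_l a b); assert (H2 := Rmin_r a b).
split; [apply HP|apply HQ]; lra.
Qed.

Lemma for_small_lt_div (c rho : R) : 0 < rho -> for_small (fun eps => c < rho / eps).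
Proof.
intros Hrho; assert (Hc := Rabs_pos c); assert (Hc' := Rle_abs c).
exists (rho / (Rabs c + 1)); split; [apply Rdiv_lt_0_compat; lra|].
intros eps He.
assert (H : eps * (Rabs c + 1) <= rho) by (apply Rle_div_r; lra).
apply Rlt_div_r; [lra|]; nra.
Qed.

Lemma for_small_exp_le (a b rho : R) : 0 < a -> 0 < b -> 0 < rho ->
  for_small (fun eps => a * exp (- (rho / eps)) <= b).
Proof.
intros Ha Hb Hrho; destruct (for_small_lt_div (a / b) rho Hrho) as (e0 & He0 & H).
exists e0; split; trivial; intros eps He; specialize (H eps He).
assert (Hab : 0 < a / b) by (apply Rdiv_lt_0_compat; lra).
apply Rle_trans with (a * / (a / b)); [|apply Req_le; field; lra].
apply Rmult_le_compat_l; [lra|].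
apply Rle_trans with (/ (rho / eps)); [apply exp_neg_le_inv; lra|].
apply Rinv_le_contravar; lra.
Qed.

(** Squaring [exp (x / 2) >= 1 + x / 2] gives a bound quadratic in [1 / eps], which beats
    [(a + b) / eps]. *)
Lemma for_small_linear_lt_exp (a b c delta : R) : 0 <= a -> 0 <= b -> 0 < c -> 0 < delta ->
  for_small (fun eps => a / eps + b < c * exp (delta / eps)).
Proof.
intros Ha Hb Hc Hd.
destruct (for_small_and _ _ (for_small_lt_div 1 1 Rlt_0_1)
  (for_small_lt_div ((a + b) / (c * (delta / 2 * (delta / 2)))) 1 Rlt_0_1)) as (e0 & He0 & H).
exists e0; split; trivial; intros eps He; destruct (H eps He) as [H1 H2].
assert (Hi : delta / eps = delta * (1 / eps)) by (field; lra).
replace (a / eps) with (a * (1 / eps)) by (field; lra); rewrite Hi.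
set (u := 1 / eps) in *.
assert (H3 : exp (delta * u) = exp (delta * u / 2) * exp (delta * u / 2))
  by (rewrite <- exp_plus; f_equal; field).
assert (H4 := exp_ineq1_le (delta * u / 2)).
assert (H5 : 0 < delta * u) by nra.
assert (H6 : delta * u / 2 * (delta * u / 2) < exp (delta * u)) by (rewrite H3; nra).
assert (H7 : a + b < u * (c * (delta / 2 * (delta / 2)))).
{ apply Rlt_div_l; trivial; apply Rlt_gt, Rmult_lt_0_compat; nra. }
assert (c * (delta * u / 2 * (delta * u / 2)) < c * exp (delta * u)) by nra.
nra.
Qed.

Lemma for_small_at_right (P : R -> Prop) : for_small P -> at_right 0 P.
Proof.
intros (e0 & He0 & H); exists (mkposreal e0 He0); intros y Hy Hy0.
apply H; unfold ball in Hy; simpl in Hy.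
unfold AbsRing_ball, abs, minus, plus, opp in Hy; simpl in Hy.
apply Rabs_lt_between in Hy; lra.
Qed.

Lemma size_bound (J : R -> Prop) (m b : R) : (exists a, J a) ->
  (forall y, J y -> Rabs (y - m) <= b) -> Rbar_le (Rbar_abs (size J)) (2 * b).
Proof.
intros [a Ha] HJ; unfold size.
destruct (Lub_Rbar_correct J) as [Hlu Hll]; destruct (Glb_Rbar_correct J) as [Hgl Hgu].
specialize (Hlu a Ha); specialize (Hgl a Ha).
assert (Hl : Rbar_le (Lub_Rbar J) (m + b)).
{ apply Hll; intros y Hy; simpl; specialize (HJ y Hy); apply Rabs_le_between in HJ; lra. }
assert (Hg : Rbar_le (m - b) (Glb_Rbar J)).
{ apply Hgu; intros y Hy; simpl; specialize (HJ y Hy); apply Rabs_le_between in HJ; lra. }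
destruct (Lub_Rbar J) as [l| |]; destruct (Glb_Rbar J) as [g| |]; simpl in *; try easy.
apply Rabs_le; lra.
Qed.

(** Choice makes the map total; its value is determined wherever the crossing exists and is
    unique. *)
Definition transition (lam eps : R) (Dout : R * R -> Prop) (p : R * R) : R * R :=
  epsilon (inhabits (0, 0)) (fun q => forward_orbit lam eps p q /\ Dout q).

Lemma transition_eq (lam eps : R) (Dout : R * R -> Prop) (p q0 : R * R) :
  (forall q, forward_orbit lam eps p q /\ Dout q <-> q = q0) ->
  transition lam eps Dout p = q0.
Proof.
intros H; apply H; unfold transition; apply epsilon_spec.
now exists q0; apply H.
Qed.

Definition in_point (rho lam eps r : R) : R * R := (- rho, - rho + eps * (1 - lam) + r).

Lemma offset_bound (rho delta eps r : R) : 0 < eps -> delta < rho / 2 -> Rabs r < delta ->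
  Rabs (r / eps) <= rho / eps / 2.
Proof.
intros He Hd Hr; unfold Rdiv; rewrite Rabs_mult, Rabs_inv, (Rabs_right eps) by lra.
replace (rho * / eps * / 2) with (rho / 2 * / eps) by (field; lra).
apply Rmult_le_compat_r; [left; now apply Rinv_0_lt_compat|lra].
Qed.

Lemma div_between (eps a b P delta : R) : 0 < eps -> Rabs a < delta -> Rabs b < delta ->
  Rmin (a / eps) (b / eps) <= P <= Rmax (a / eps) (b / eps) -> Rabs (eps * P) < delta.
Proof.
intros He Ha Hb HP.
apply Rabs_lt_between in Ha; apply Rabs_lt_between in Hb; apply Rabs_lt_between.
assert (Hae : eps * (a / eps) = a) by (field; lra).
assert (Hbe : eps * (b / eps) = b) by (field; lra).
revert HP; unfold Rmin, Rmax; destruct Rle_dec; intros HP; split; nra.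
Qed.

(** * Exit to the right for [lam > 1] *)

Section Right.
Variables rho delta lam : R.
Hypotheses (rho_pos : 0 < rho) (delta_pos : 0 < delta) (delta_lt : delta < rho / 2)
  (lam_gt : 1 < lam).

(** In order: the entry estimates apply and [eps < 1]; the growth coefficient is at least [lam - 1];
    no crossing occurs up to [s = 0]; the crossing lies below height [delta]; [h] obeys its
    logarithmic bound. *)
Definition small_right (eps : R) : Prop :=
  (2 < rho / eps /\ 1 < 1 / eps) /\
  6 * exp lam * exp (- (rho / 4 / eps)) <= lam - 1 /\
  (1 + lam) * exp lam < rho / eps /\
  rho / eps + lam < (lam - 1) * exp (delta / eps) /\
  (rho + lam) / (lam - 1) < 1 / eps.

Lemma for_small_right : for_small small_right.
Proof.
assert (He := exp_pos lam).
repeat apply for_small_and; try apply for_small_lt_div; try lra.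
- apply for_small_exp_le; lra.
- apply for_small_linear_lt_exp; lra.
Qed.

Lemma transition_right (eps r : R) : 0 < eps -> small_right eps -> Rabs r < delta ->
  let k := entry_value (rho / eps) (r / eps) in
  Rabs (k + 1) <= 6 * exp (- (rho / 4 / eps)) /\ lam - 1 <= growth_coeff lam k /\
  exists s, 0 <= s < delta / eps /\ s + growth_coeff lam k * exp s = rho / eps - 1 + lam /\
    (forall u, - lam <= u -> (flow lam k u = rho / eps <-> u = s)) /\
    forall q, forward_orbit lam eps (in_point rho lam eps r) q /\ Delta_out_e rho delta q
      <-> q = (rho, eps * s).
Proof.
intros Heps ((HN & _) & Hk & HN' & HD & _) Hr k.
assert (HR := offset_bound rho delta eps r Heps delta_lt Hr).
assert (Hke : Rabs (k + 1) <= 6 * exp (- (rho / 4 / eps))).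
{ replace (rho / 4 / eps) with (rho / eps / 4) by (field; lra).
  apply entry_value_bound; lra. }
assert (Hk1 : Rabs (k + 1) * exp lam <= lam - 1) by (assert (He := exp_pos lam); nra).
assert (Hk0 : k <= 0).
{ unfold k, entry_value.
  assert (H := entry lam (rho / eps) (r / eps) (flow lam k) ltac:(lra) ltac:(lra) HR
    (flow_solution _ _) (flow_start _ _)).
  apply Rabs_le_between in HR.
  destruct H as [_ H]; specialize (H (- lam) ltac:(lra)); now rewrite flow_start in H. }
split; [trivial|split; [now apply growth_coeff_ge|]].
destruct (right_crossing lam k (rho / eps) (delta / eps)) as (s & Hs & Heq & Hu); trivial.
{ now apply Rdiv_lt_0_compat. }
assert (HsD : eps * s < delta).
{ replace delta with (eps * (delta / eps)) by (field; lra); apply Rmult_lt_compat_l; lra. }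
exists s; split; [trivial|split; [trivial|split; [trivial|]]].
intros [x1 y1]; unfold in_point; rewrite delta_in_forward_orbit by lra; fold k; simpl; split.
- intros ((Hy & Hx) & r' & Hr' & Hq); injection Hq as -> ->.
  assert (Hf : flow lam k (r' / eps) = rho / eps) by (rewrite Hx; field; lra).
  f_equal; replace r' with (eps * (r' / eps)) by (field; lra); f_equal.
  (* A crossing before [s = - lam] is excluded, since the solution is nonpositive during the entry
     phase. *)
  apply Hu; trivial; apply Rnot_lt_le; intros Hlt.
  destruct (entry lam (rho / eps) (r / eps) (flow lam k)) as [_ H]; try lra;
    [apply flow_solution|apply flow_start|].
  assert (- (rho / eps) + 1 - lam + r / eps <= r' / eps).
  { apply Rle_div_r; [lra|]; eapply Rle_trans; [|exact Hy]; apply Req_le; field; lra. }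
  specialize (H (r' / eps) ltac:(lra)); lra.
- intros Hq; injection Hq as -> ->; split; [split|].
  + apply Rabs_lt_between in Hr; nra.
  + replace (eps * s / eps) with s by (field; lra).
    rewrite (proj2 (Hu s ltac:(lra)) eq_refl); field; lra.
  + exists (eps * s); split; trivial; apply Rabs_lt_between; nra.
Qed.

Let Pi (eps : R) : R * R -> R * R := transition lam eps (Delta_out_e rho delta).
Let J (eps y : R) : Prop := image (Pi eps) (Delta_in rho delta lam eps) (rho, y).
(** Offset 0 has entry value [- 1], so this is also the crossing of the orbit of [p_a_minus]. *)
Let h (eps : R) : R := snd (Pi eps (in_point rho lam eps 0)).

Lemma image_right (eps y : R) : 0 < eps -> small_right eps ->
  J eps y <-> exists r, Rabs r < delta /\ 0 <= y /\
    flow lam (entry_value (rho / eps) (r / eps)) (y / eps) = rho / eps.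
Proof.
intros Heps Hsm; split.
- intros (p & (r & Hr & ->) & Hp); exists r; split; trivial.
  destruct (transition_right eps r Heps Hsm Hr) as (_ & _ & s & Hs & _ & Hu & Ht).
  unfold Pi in Hp; fold (in_point rho lam eps r) in Hp.
  rewrite (transition_eq _ _ _ _ _ Ht) in Hp; injection Hp as <-.
  split; [nra|]; apply Hu.
  + replace (eps * s / eps) with s by (field; lra); lra.
  + field; lra.
- intros (r & Hr & Hy & Hf); exists (in_point rho lam eps r); split; [now exists r|].
  destruct (transition_right eps r Heps Hsm Hr) as (_ & _ & s & Hs & _ & Hu & Ht).
  unfold Pi; rewrite (transition_eq _ _ _ _ _ Ht); f_equal.
  apply Hu in Hf; [rewrite <- Hf; field; lra|].
  apply Rle_trans with 0; [lra|].
  apply Rmult_le_pos; [lra|left; now apply Rinv_0_lt_compat].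
Qed.

Lemma Rabs_0_lt : Rabs 0 < delta.
Proof. now rewrite Rabs_R0. Qed.

Lemma image_right_nonempty (eps : R) : 0 < eps -> small_right eps -> J eps (h eps).
Proof.
intros Heps Hsm; exists (in_point rho lam eps 0); split.
- exists 0; split; [apply Rabs_0_lt|reflexivity].
- destruct (transition_right eps 0 Heps Hsm Rabs_0_lt) as (_ & _ & s & _ & _ & _ & Ht).
  unfold h, Pi; now rewrite (transition_eq _ _ _ _ _ Ht).
Qed.

(** Solutions increase for [s >= 0]: at height [c] the one that crossed at [a] is at least [N], the
    one crossing at [b] at most [N], and some offset in between attains [N]. *)
Lemma image_right_interval (eps : R) : 0 < eps -> small_right eps -> is_interval (J eps).
Proof.
intros Heps Hsm; split; [exists (h eps); now apply image_right_nonempty|].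
intros a b c Ha Hb Hc.
apply image_right in Ha as (ra & Hra & Ha & Hfa); trivial.
apply image_right in Hb as (rb & Hrb & Hb & Hfb); trivial.
apply image_right; trivial.
destruct (transition_right eps ra Heps Hsm Hra) as (_ & Hwa & _).
destruct (transition_right eps rb Heps Hsm Hrb) as (_ & Hwb & _).
assert (Hd : forall x y, x <= y -> x / eps <= y / eps).
{ intros x y H; apply Rmult_le_compat_r; trivial; left; now apply Rinv_0_lt_compat. }
assert (Hac := Hd a c ltac:(lra)); assert (Hcb := Hd c b ltac:(lra)).
assert (Ha0 := Hd 0 a Ha); unfold Rdiv in Ha0 at 1; rewrite Rmult_0_l in Ha0.
assert (Hmono : forall k x y, lam - 1 <= growth_coeff lam k -> 0 <= x <= y ->
  flow lam k x <= flow lam k y).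
{ intros k x y Hw Hxy; rewrite !flow_right by lra.
  assert (exp x <= exp y) by (apply exp_le; lra); nra. }
destruct (entry_IVT lam (rho / eps) (c / eps) (rho / eps) (ra / eps) (rb / eps))
  as (P & HP & HfP).
- rewrite <- Hfa at 1; apply Hmono; trivial; lra.
- rewrite <- Hfb at 2; apply Hmono; trivial; lra.
- exists (eps * P); split; [now apply (div_between eps ra rb)|split; [lra|]].
  now replace (eps * P / eps) with P by (field; lra).
Qed.

Lemma small_right_lt_1 (eps : R) : 0 < eps -> small_right eps -> eps < 1.
Proof.
intros Heps ((_ & H) & _); apply Rlt_div_r in H; lra.
Qed.

Lemma entry_value_0 (N eps : R) : entry_value N (0 / eps) = - 1.
Proof. unfold entry_value, Rdiv; ring. Qed.

Lemma image_right_width (eps y : R) : 0 < eps -> small_right eps -> J eps y ->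
  Rabs (y - h eps) <= 6 * exp lam / (lam - 1) * exp (- (rho / 4) / eps).
Proof.
intros Heps Hsm (p & (r & Hr & ->) & Hp).
destruct (transition_right eps r Heps Hsm Hr) as (Hk & Hw & s & Hs & Heq & _ & Ht).
destruct (transition_right eps 0 Heps Hsm Rabs_0_lt) as (_ & Hw0 & t & _ & Heqt & _ & Htt).
rewrite entry_value_0 in Hw0, Heqt.
unfold Pi in Hp; fold (in_point rho lam eps r) in Hp.
rewrite (transition_eq _ _ _ _ _ Ht) in Hp; injection Hp as <-.
unfold h, Pi; rewrite (transition_eq _ _ _ _ _ Htt); simpl.
set (k := entry_value (rho / eps) (r / eps)) in *.
assert (Hst := right_crossing_close (lam - 1) (growth_coeff lam k) (growth_coeff lam (- 1)) s t
  ltac:(lra) Hw Hw0 ltac:(lra)).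
assert (Hc := growth_coeff_close lam k ltac:(lra)).
replace (eps * s - eps * t) with (eps * (s - t)) by ring.
rewrite Rabs_mult, (Rabs_right eps) by lra.
assert (He := small_right_lt_1 eps Heps Hsm).
assert (H1 := Rabs_pos (s - t)).
apply Rle_trans with (Rabs (s - t)); [nra|].
eapply Rle_trans; [exact Hst|].
replace (- (rho / 4) / eps) with (- (rho / 4 / eps)) by (field; lra).
replace (6 * exp lam / (lam - 1) * exp (- (rho / 4 / eps))) with
  (6 * exp (- (rho / 4 / eps)) * exp lam / (lam - 1)) by (field; lra).
apply Rmult_le_compat_r; [left; apply Rinv_0_lt_compat; lra|].
eapply Rle_trans; [exact Hc|]; apply Rmult_le_compat_r; trivial; left; apply exp_pos.
Qed.

(** If [s > - 2 ln eps], then [exp s > 1 / eps^2], and [w exp s] exceeds [(rho + lam) / eps], too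
    much for the crossing equation. *)
Lemma h_bound (eps : R) : 0 < eps -> small_right eps ->
  Rabs (h eps) <= 2 * Rabs (eps * ln eps).
Proof.
intros Heps Hsm; assert (He := small_right_lt_1 eps Heps Hsm).
destruct (transition_right eps 0 Heps Hsm Rabs_0_lt) as (_ & Hw & s & Hs & Heq & _ & Ht).
unfold h, Pi; rewrite (transition_eq _ _ _ _ _ Ht); simpl.
assert (Hln : ln eps < 0) by (rewrite <- ln_1; apply ln_increasing; lra).
rewrite !Rabs_mult, (Rabs_right eps), (Rabs_right s), (Rabs_left (ln eps)) by lra.
enough (s <= - (2 * ln eps)) by nra.
apply Rnot_lt_le; intros H; apply exp_increasing in H.
replace (- (2 * ln eps)) with (- ln eps + - ln eps) in H by ring.
rewrite exp_plus, exp_Ropp, exp_ln in H by trivial.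
destruct Hsm as (_ & _ & _ & _ & Hq).
replace (1 / eps) with (/ eps) in Hq by (field; lra).
assert (Hinv : / eps * eps = 1) by (field; lra).
assert (Hi : 1 < / eps) by (rewrite <- Rinv_1; apply Rinv_lt_contravar; lra).
unfold Rdiv in Heq; set (u := / eps) in *.
assert (Hq' : rho + lam < u * (lam - 1)) by (apply Rlt_div_l; lra).
set (w := growth_coeff lam _) in *.
assert (H1 : (lam - 1) * (u * u) < w * exp s) by (assert (H2 := exp_pos s); nra).
assert (H2 : (rho + lam) * u < (lam - 1) * (u * u)) by nra.
nra.
Qed.

Lemma right_exit_transition :
  exists eps0 : R, 0 < eps0 /\
    exists (h : R -> R) (Pi_e : R -> R * R -> R * R) (J : R -> R -> Prop) (c : R),
      0 < c /\
      is_bigO_0 (fun eps => Finite (h eps)) (fun eps => eps * ln eps) /\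
      is_bigO_0 (fun eps => size (J eps)) (fun eps => exp (- c / eps)) /\
      forall eps : R, 0 < eps <= eps0 ->
        p_a_minus lam eps = (0, eps * (1 - lam)) /\
        (forall q : R * R,
          (orbit lam eps (p_a_minus lam eps) q /\ Delta_out_e rho delta q)
          <-> q = (rho, h eps)) /\
        is_transition_map lam eps
          (Delta_in rho delta lam eps) (Delta_out_e rho delta) (Pi_e eps) /\
        is_interval (J eps) /\
        (forall q : R * R,
          image (Pi_e eps) (Delta_in rho delta lam eps) q <-> vertical rho (J eps) q) /\
        (forall q : R * R,
          orbit lam eps (p_a_minus lam eps) q -> Delta_out_e rho delta q ->
          vertical rho (J eps) q).
Proof.
destruct for_small_right as (eps0 & Heps0 & Hsmall).
exists eps0; split; trivial; exists h, Pi, J, (rho / 4).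
split; [lra|split; [|split]].
- exists 2; apply for_small_at_right; exists eps0; split; trivial.
  intros eps Heps; apply h_bound; [lra|now apply Hsmall].
- exists (2 * (6 * exp lam / (lam - 1))); apply for_small_at_right; exists eps0; split; trivial.
  intros eps Heps; specialize (Hsmall eps Heps).
  rewrite (Rabs_right (exp _)) by (left; apply exp_pos); rewrite Rmult_assoc.
  apply size_bound with (h eps).
  + exists (h eps); apply image_right_nonempty; trivial; lra.
  + intros y Hy; apply image_right_width; trivial; lra.
- intros eps Heps; specialize (Hsmall eps Heps); destruct Heps as [Heps _].
  assert (Hp : p_a_minus lam eps = (0, eps * (1 - lam))).
  { unfold p_a_minus; rewrite Rmin_left by nra; f_equal; ring. }
  assert (Horb : forall q, orbit lam eps (p_a_minus lam eps) q /\ Delta_out_e rho delta q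
    <-> q = (rho, h eps)).
  { intros [x1 y1]; rewrite Hp, (orbit_scaled lam eps 0 _ (flow lam (- 1)));
      [|trivial|apply flow_solution|].
    2:{ replace (eps * (1 - lam) / eps) with (1 - lam) by (field; lra).
        rewrite flow_slow_manifold by (try rewrite Rmin_right; lra); ring. }
    destruct (transition_right eps 0 Heps Hsmall Rabs_0_lt) as (_ & _ & s & Hs & _ & Hu & Ht).
    rewrite entry_value_0 in Hu.
    replace (h eps) with (eps * s)
      by (unfold h, Pi; now rewrite (transition_eq _ _ _ _ _ Ht)).
    simpl; split.
    - intros (Hx & r & Hr & Hq); injection Hq as -> ->; f_equal.
      assert (Hf : flow lam (- 1) (r / eps) = rho / eps) by (rewrite Hx; field; lra).
      replace r with (eps * (r / eps)) by (field; lra); f_equal.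
      (* The full orbit also has a part with [s < - lam]; there it follows the line [s - 1 + lam],
         which is negative. *)
      apply Hu; trivial; apply Rnot_lt_le; intros Hlt.
      rewrite flow_slow_manifold in Hf by (try rewrite Rmin_right; lra).
      assert (0 < rho / eps) by (now apply Rdiv_lt_0_compat). lra.
    - intros Hq; injection Hq as -> ->; split.
      + replace (eps * s / eps) with s by (field; lra).
        rewrite (proj2 (Hu s ltac:(lra)) eq_refl); field; lra.
      + destruct (proj2 (Ht (rho, eps * s)) eq_refl) as [_ H]; exact H. }
  split; [trivial|split; [trivial|split; [|split; [|split]]]].
  + intros p (r & Hr & ->) q.
    destruct (transition_right eps r Heps Hsmall Hr) as (_ & _ & s & _ & _ & _ & Ht).
    unfold Pi; fold (in_point rho lam eps r).
    now rewrite (transition_eq _ _ _ _ _ Ht).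
  + now apply image_right_interval.
  + intros [x1 y1]; split.
    * intros Hq; assert (Hq' := Hq); destruct Hq' as (p & (r & Hr & ->) & Heq).
      destruct (transition_right eps r Heps Hsmall Hr) as (_ & _ & s & _ & _ & _ & Ht).
      unfold Pi in Heq; fold (in_point rho lam eps r) in Heq.
      rewrite (transition_eq _ _ _ _ _ Ht) in Heq; injection Heq as <- _.
      split; [reflexivity|exact Hq].
    * intros [Hx Hy]; simpl in Hx, Hy; now rewrite Hx.
  + intros q Hq1 Hq2; rewrite (proj1 (Horb q) (conj Hq1 Hq2)).
    split; [reflexivity|]; now apply image_right_nonempty.
Qed.

End Right.

(** * Exit to the left for [lam < 1] *)

Section Left.
Variables rho delta lam S Z m : R.
Hypotheses (rho_pos : 0 < rho) (delta_pos : 0 < delta) (delta_lt : delta < rho / 2)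
  (lam_pos : 0 < lam) (Z_pos : 0 < Z) (m_pos : 0 < m)
  (flow_tail : forall k, Rabs (k + 1) <= m ->
     exists z, Rabs z <= Z /\
       forall s, S <= s -> flow lam k s = 1 + lam - s + z * exp (- s)).

Definition small_left (eps : R) : Prop :=
  (2 < rho / eps /\ S < rho / 2 / eps) /\
  (1 < delta / eps /\ 1 < 1 / eps) /\
  6 * exp (- (rho / 4 / eps)) <= m /\
  Z * exp (- (rho / 2 / eps)) <= 1 / 2.

Lemma for_small_left : for_small small_left.
Proof.
repeat apply for_small_and; try apply for_small_lt_div; try apply for_small_exp_le; lra.
Qed.

Lemma transition_left (eps r : R) : 0 < eps -> small_left eps -> Rabs r < delta ->
  let k := entry_value (rho / eps) (r / eps) in
  (forall x y, rho / eps / 2 <= x <= y -> flow lam k y <= flow lam k x) /\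
  exists s, Rabs (s - (rho / eps + 1 + lam)) <= Z * exp (- (rho / 2 / eps)) /\
    (forall u, rho / eps / 2 <= u -> (flow lam k u = - (rho / eps) <-> u = s)) /\
    forall q, forward_orbit lam eps (in_point rho lam eps r) q /\ Delta_out_a rho delta lam eps q
      <-> q = (- rho, eps * s).
Proof.
intros Heps ((HN & HS) & (HD & _) & Hm & HZ) Hr k.
assert (HR := offset_bound rho delta eps r Heps delta_lt Hr).
assert (Hdr : delta / eps < rho / eps / 2).
{ replace (rho / eps / 2) with (rho / 2 / eps) by (field; lra).
  apply Rmult_lt_compat_r; [now apply Rinv_0_lt_compat|trivial]. }
assert (Hk : Rabs (k + 1) <= m).
{ eapply Rle_trans; [|exact Hm].
  replace (rho / 4 / eps) with (rho / eps / 4) by (field; lra).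
  apply entry_value_bound; lra. }
replace (rho / 2 / eps) with (rho / eps / 2) in * by (field; lra).
destruct (flow_tail k Hk) as (z & Hz & Hf).
split.
{ intros x y Hxy; rewrite !Hf by lra.
  assert (H := left_decreasing lam z Z (rho / eps) x y Hz HZ Hxy); lra. }
destruct (left_crossing lam S Z z k (rho / eps) (delta / eps)) as (s & Hs & Hu);
  trivial; try lra.
assert (HsD := Hs); apply Rabs_le_between in HsD.
exists s; split; [trivial|split; [trivial|]].
assert (Hrho : rho = eps * (rho / eps)) by (field; lra).
assert (Hdelta : delta = eps * (delta / eps)) by (field; lra).
intros [x1 y1]; unfold in_point; rewrite delta_in_forward_orbit by lra; fold k; simpl; split.
- intros ((Hy & Hx) & r' & Hr' & Hq); injection Hq as -> ->.
  set (u := (rho + eps * (1 + lam) + r') / eps) in *.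
  assert (Hyu : rho + eps * (1 + lam) + r' = eps * u) by (unfold u; field; lra).
  assert (Hfu : flow lam k u = - (rho / eps)).
  { apply Rmult_eq_reg_l with eps; [|lra]; rewrite <- Hx; field; lra. }
  rewrite Hyu; do 2 f_equal; apply Hu; trivial.
  (* The orbit starts on [x = - rho] too, but [delta < rho / 2] confines the exit section to
     [u >= N / 2], where the crossing is unique. *)
  apply Rabs_lt_between in Hr'; apply Rmult_le_reg_l with eps; trivial; nra.
- intros Hq; injection Hq as -> ->; split; [split|].
  + apply Rabs_lt_between in Hr; nra.
  + replace (eps * s / eps) with s by (field; lra).
    rewrite (proj2 (Hu s ltac:(lra)) eq_refl); field; lra.
  + exists (eps * (s - (rho / eps + 1 + lam))); split.
    * rewrite Rabs_mult, (Rabs_right eps) by lra; nra.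
    * f_equal; field; lra.
Qed.

Let Pi (eps : R) : R * R -> R * R := transition lam eps (Delta_out_a rho delta lam eps).
(* The image need not contain a point of the slow manifold, only points exponentially
   close to it, so the interval is a neighbourhood of the manifold. *)
Let J (eps y : R) : Prop :=
  Rabs (y - (rho + eps * (1 + lam))) <= eps * (Z * exp (- (rho / 2 / eps))).

Lemma image_left (eps y : R) : 0 < eps -> small_left eps ->
  image (Pi eps) (Delta_in rho delta lam eps) (- rho, y) <->
  rho / eps / 2 <= y / eps /\ exists r, Rabs r < delta /\
    flow lam (entry_value (rho / eps) (r / eps)) (y / eps) = - (rho / eps).
Proof.
intros Heps Hsm; split.
- intros (p & (r & Hr & ->) & Hp).
  destruct (transition_left eps r Heps Hsm Hr) as (_ & s & Hs & Hu & Ht).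
  unfold Pi in Hp; fold (in_point rho lam eps r) in Hp.
  rewrite (transition_eq _ _ _ _ _ Ht) in Hp; injection Hp as <-.
  destruct Hsm as ((HN & _) & _ & _ & HZ).
  apply Rabs_le_between in Hs.
  assert (Hes : eps * s / eps = s) by (field; lra); rewrite Hes.
  split; [lra|]; exists r; split; trivial; apply Hu; lra.
- intros (Hy & r & Hr & Hf); exists (in_point rho lam eps r); split; [now exists r|].
  destruct (transition_left eps r Heps Hsm Hr) as (_ & s & Hs & Hu & Ht).
  unfold Pi; rewrite (transition_eq _ _ _ _ _ Ht); f_equal.
  apply Hu in Hf; [rewrite <- Hf; field; lra|trivial].
Qed.

(** As for the right exit, but the solutions decrease for [s >= N / 2], so the roles of [ra] and
    [rb] are exchanged. *)
Lemma image_left_interval (eps : R) : 0 < eps -> small_left eps ->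
  is_interval (fun y => image (Pi eps) (Delta_in rho delta lam eps) (- rho, y)).
Proof.
intros Heps Hsm; split.
{ assert (H0 : Rabs 0 < delta) by now rewrite Rabs_R0.
  destruct (transition_left eps 0 Heps Hsm H0) as (_ & s & _ & _ & Ht).
  exists (eps * s), (in_point rho lam eps 0); split; [now exists 0|].
  now apply transition_eq. }
intros a b c Ha Hb Hc.
apply image_left in Ha as (Ha & ra & Hra & Hfa); trivial.
apply image_left in Hb as (Hb & rb & Hrb & Hfb); trivial.
apply image_left; trivial.
destruct (transition_left eps ra Heps Hsm Hra) as (Hma & _).
destruct (transition_left eps rb Heps Hsm Hrb) as (Hmb & _).
assert (Hd : forall x y, x <= y -> x / eps <= y / eps).
{ intros x y H; apply Rmult_le_compat_r; trivial; left; now apply Rinv_0_lt_compat. }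
assert (Hac := Hd a c ltac:(lra)); assert (Hcb := Hd c b ltac:(lra)).
split; [lra|].
destruct (entry_IVT lam (rho / eps) (c / eps) (- (rho / eps)) (rb / eps) (ra / eps))
  as (P & HP & HfP).
- rewrite <- Hfb; apply Hmb; lra.
- rewrite <- Hfa; apply Hma; lra.
- exists (eps * P); split; [now apply (div_between eps rb ra)|].
  now replace (eps * P / eps) with P by (field; lra).
Qed.

Lemma J_width_pos (eps : R) : 0 < eps -> 0 < eps * (Z * exp (- (rho / 2 / eps))).
Proof.
intros Heps; apply Rmult_lt_0_compat; trivial.
apply Rmult_lt_0_compat; trivial; apply exp_pos.
Qed.

Lemma left_exit_transition :
  exists eps0 : R, 0 < eps0 /\
    exists (Pi_a : R -> R * R -> R * R) (J : R -> R -> Prop) (c : R),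
      0 < c /\
      is_bigO_0 (fun eps => size (J eps)) (fun eps => exp (- c / eps)) /\
      forall eps : R, 0 < eps <= eps0 ->
        is_transition_map lam eps
          (Delta_in rho delta lam eps) (Delta_out_a rho delta lam eps) (Pi_a eps) /\
        is_interval (J eps) /\
        (forall q : R * R,
          vertical (- rho) (J eps) q -> Delta_out_a rho delta lam eps q) /\
        is_interval (fun y =>
          image (Pi_a eps) (Delta_in rho delta lam eps) (- rho, y)) /\
        (forall q : R * R,
          image (Pi_a eps) (Delta_in rho delta lam eps) q ->
          vertical (- rho) (J eps) q) /\
        (forall q : R * R,
          slow_manifold_a_plus lam eps q -> Delta_out_a rho delta lam eps q ->
          vertical (- rho) (J eps) q).
Proof.
destruct for_small_left as (eps0 & Heps0 & Hsmall).
exists eps0; split; trivial; exists Pi, J, (rho / 2).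
assert (Hcenter : forall eps, 0 < eps -> J eps (rho + eps * (1 + lam))).
{ intros eps Heps; unfold J; rewrite Rminus_diag, Rabs_R0; left; now apply J_width_pos. }
split; [lra|split].
- exists (2 * Z); apply for_small_at_right; exists eps0; split; trivial.
  intros eps Heps; destruct (Hsmall eps Heps) as (_ & (_ & H1) & _).
  apply Rlt_div_r in H1; [|lra].
  rewrite (Rabs_right (exp _)) by (left; apply exp_pos); rewrite Rmult_assoc.
  apply size_bound with (rho + eps * (1 + lam)).
  + exists (rho + eps * (1 + lam)); apply Hcenter; lra.
  + intros y Hy; eapply Rle_trans; [exact Hy|].
    replace (- (rho / 2) / eps) with (- (rho / 2 / eps)) by (field; lra).
    assert (He := exp_pos (- (rho / 2 / eps))).
    assert (0 < Z * exp (- (rho / 2 / eps))) by nra. nra.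
- intros eps Heps; specialize (Hsmall eps Heps); destruct Heps as [Heps _].
  split; [|split; [|split; [|split; [|split]]]].
  + intros p (r & Hr & ->) q.
    destruct (transition_left eps r Heps Hsmall Hr) as (_ & s & _ & _ & Ht).
    unfold Pi; fold (in_point rho lam eps r).
    now rewrite (transition_eq _ _ _ _ _ Ht).
  + split; [eexists; now apply Hcenter|].
    unfold J; intros a b c Ha Hb Hc; apply Rabs_le_between in Ha; apply Rabs_le_between in Hb.
    apply Rabs_le_between; lra.
  + intros [x1 y1] [Hx Hy]; simpl in Hx, Hy; rewrite Hx.
    exists (y1 - (rho + eps * (1 + lam))); split; [|f_equal; ring].
    eapply Rle_lt_trans; [exact Hy|].
    (* The half-width is at most [eps / 2], and [eps < delta]. *)
    destruct Hsmall as (_ & (HD & _) & _ & HZ); apply Rlt_div_r in HD; nra.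
  + now apply image_left_interval.
  + intros q (p & (r & Hr & ->) & <-).
    destruct (transition_left eps r Heps Hsmall Hr) as (_ & s & Hs & _ & Ht).
    unfold Pi; fold (in_point rho lam eps r); rewrite (transition_eq _ _ _ _ _ Ht).
    split; [reflexivity|]; unfold J; simpl.
    replace (eps * s - (rho + eps * (1 + lam))) with (eps * (s - (rho / eps + 1 + lam)))
      by (field; lra).
    rewrite Rabs_mult, (Rabs_right eps) by lra; now apply Rmult_le_compat_l; [lra|].
  + intros [x1 y1] [Hq _] (r & _ & Hr); injection Hr as -> ->; simpl in Hq.
    split; [reflexivity|]; simpl; rewrite Hq.
    replace (- - rho + eps * (1 + lam)) with (rho + eps * (1 + lam)) by ring.
    now apply Hcenter.
Qed.

End Left.

Theorem theorem3p1 :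
  forall rho : R, 0 < rho ->
  exists delta0 : R, 0 < delta0 /\
  forall delta : R, 0 < delta < delta0 ->
  forall lam : R, 0 < lam ->
  exists eps0 : R, 0 < eps0 /\
  (1 < lam ->
    exists (h : R -> R) (Pi_e : R -> R * R -> R * R) (J : R -> R -> Prop) (c : R),
      0 < c /\
      is_bigO_0 (fun eps => Finite (h eps)) (fun eps => eps * ln eps) /\
      is_bigO_0 (fun eps => size (J eps)) (fun eps => exp (- c / eps)) /\
      forall eps : R, 0 < eps <= eps0 ->
        p_a_minus lam eps = (0, eps * (1 - lam)) /\
        (forall q : R * R,
          (orbit lam eps (p_a_minus lam eps) q /\ Delta_out_e rho delta q)
          <-> q = (rho, h eps)) /\
        is_transition_map lam eps
          (Delta_in rho delta lam eps) (Delta_out_e rho delta) (Pi_e eps) /\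
        is_interval (J eps) /\
        (forall q : R * R,
          image (Pi_e eps) (Delta_in rho delta lam eps) q <-> vertical rho (J eps) q) /\
        (forall q : R * R,
          orbit lam eps (p_a_minus lam eps) q -> Delta_out_e rho delta q ->
          vertical rho (J eps) q)) /\
  (lam < 1 ->
    exists (Pi_a : R -> R * R -> R * R) (J : R -> R -> Prop) (c : R),
      0 < c /\
      is_bigO_0 (fun eps => size (J eps)) (fun eps => exp (- c / eps)) /\
      forall eps : R, 0 < eps <= eps0 ->
        is_transition_map lam eps
          (Delta_in rho delta lam eps) (Delta_out_a rho delta lam eps) (Pi_a eps) /\
        is_interval (J eps) /\
        (forall q : R * R,
          vertical (- rho) (J eps) q -> Delta_out_a rho delta lam eps q) /\
        is_interval (fun y =>
          image (Pi_a eps) (Delta_in rho delta lam eps) (- rho, y)) /\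
        (forall q : R * R,
          image (Pi_a eps) (Delta_in rho delta lam eps) q ->
          vertical (- rho) (J eps) q) /\
        (forall q : R * R,
          slow_manifold_a_plus lam eps q -> Delta_out_a rho delta lam eps q ->
          vertical (- rho) (J eps) q)).
Proof.
(* This choice gives [|r / eps| <= N / 2], as the entry estimates require, for all [lam] at once. *)
intros rho Hrho; exists (rho / 2); split; [lra|].
intros delta Hdelta lam Hlam.
destruct (Rtotal_order lam 1) as [Hl|[Hl|Hl]].
- destruct (flow_left lam (conj Hlam Hl)) as (S & Z & m & HZ & Hm & Htail).
  destruct (left_exit_transition rho delta lam S Z m) as (eps0 & Heps0 & H); trivial; try lra.
  exists eps0; split; [trivial|split; [intros; lra|trivial]].
(* For [lam = 1] both cases are vacuous. *)
- exists 1; split; [|split]; intros; lra.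
- destruct (right_exit_transition rho delta lam) as (eps0 & Heps0 & H); trivial; try lra.
  exists eps0; split; [trivial|split; [trivial|intros; lra]].
Qed.
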